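(* Let $X,Y$ be Banach spaces, let $A$ be a closed densely defined operator on $X$ such that $-A$ is sectorial of some type $\omega\in(0,\pi)$, let $a$ be a $1$-regular kernel such that the Volterra equation $x(t)=f(t)+\int_0^t a(t-s)Ax(s)\,ds$ is parabolic, and let $(S(t))_{t\ge0}$ be a bounded solution family of this Volterra equation. Let $C:X_1\to Y$ be a bounded linear operator, where $X_1=D(A)$ is endowed with the graph norm of $A$, and assume that for some $\alpha>\tfrac12$, $$\sup_{r>0}\left\|(1+\log^+ r)^\alpha\, r^{1/2}\, C H(r)\right\|<\infty,$$ where $H(\lambda)=\frac1\lambda(I-\hat a(\lambda)A)^{-1}$ for $\operatorname{Re}\lambda>0$. Then $C$ is finite-time admissible for $(S(t))_{t\ge0}$.
   Context: Here $\log^+ r=\max(\log r,0)$, and $\Sigma_\omega=\{z\in\mathbb{C}\setminus\{0\}:|\arg z|<\omega\}$. The operator $-A$ is sectorial of type $\omega\in(0,\pi)$ if $\sigma(A)\subseteq-\Sigma_\omega$ and, on each sector $\Sigma_{\pi-\omega-\varepsilon}$, $\|\lambda R(\lambda,A)\|$ is uniformly bounded. Kernels: $a\in L^1_{\mathrm{loc}}(\mathbb{R}_+)$ is a scalar kernel of sub-exponential growth, so that its Laplace transform $\hat a(\lambda)$ exists for all $\operatorname{Re}\lambda>0$. It is $1$-regular if there is $K>0$ with $|\lambda^n\hat a^{(n)}(\lambda)|\le K|\hat a(\lambda)|$ for $n=0,1$ and all $\operatorname{Re}\lambda>0$. With $-A$ sectorial, the Volterra equation is parabolic if $\hat a(\lambda)\neq0$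 and $1/\hat a(\lambda)\in\varrho(A)$ for all $\operatorname{Re}\lambda>0$, together with Pruess' resolvent bound: there is $M>0$ with $\|H(\lambda)\|\le M/|\lambda|$ for all $\operatorname{Re}\lambda>0$. Solution family: a family of bounded linear operators $(S(t))_{t\ge0}$ on $X$ such that (i) $S(0)=I$ and $S(\cdot)$ is strongly continuous on $\mathbb{R}_+$; (ii) $S(t)D(A)\subset D(A)$ and $AS(t)x=S(t)Ax$ for $x\in D(A)$, $t\ge0$; (iii) $S(t)x=x+\int_0^t a(t-s)AS(s)x\,ds$ for $x\in D(A)$, $t\ge0$. It is bounded if $\sup_{t\ge0}\|S(t)\|<\infty$. The operator function $H$ is the Laplace transform of $S$. Finite-time admissibility: $C$ is finite-time admissible for $(S(t))_{t\ge0}$ if there are constants $\eta,K>0$ such that $\left(\int_0^t\|CS(r)x\|^2\,dr\right)^{1/2}\le Ke^{\eta t}\|x\|$ for all $t\ge0$ and all $x\in D(A)$. *)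

(* Defs.v *)
From HB Require Import structures.
From mathcomp Require Import all_boot all_order all_algebra complex.
From mathcomp Require Import all_classical all_reals all_analysis.
Set Implicit Arguments.
Unset Strict Implicit.
Unset Printing Implicit Defensive.
Import Order.TTheory GRing.Theory Num.Theory.
Import numFieldNormedType.Exports.
Local Open Scope classical_set_scope.
Local Open Scope complex_scope.
Local Open Scope ring_scope.

(* In a normed module over R[i] the library norm `|x| lives in R[i] (it is a
   nonnegative real there); rnorm and cabs are the same number, as an element
   of R. *)
Definition rnorm (R : realType) (V : normedModType R[i]) (x : V) : R :=
  complex.Re `|x|.

Definition cabs (R : realType) (z : R[i]) : R := complex.Re `|z|.

Definition cexp (R : realType) (z : R[i]) : R[i] :=
  (expR (complex.Re z))%:C * (cos (complex.Im z) +i* sin (complex.Im z)).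

Definition opnorm (R : realType) (V W : normedModType R[i]) (T : V -> W) :
    \bar R :=
  ereal_sup [set (rnorm (T x))%:E | x in [set x : V | rnorm x <= 1]].

(* th is the principal argument of z. *)
Definition sector (R : realType) (om : R) : set R[i] :=
  [set z : R[i] | z != 0 /\ exists th : R,
     [/\ - pi < th <= pi, z = (cabs z)%:C * cexp (0 +i* th) & `|th| < om]].

Definition Cintegral d (T : measurableType d) (R : realType)
    (mu : {measure set T -> \bar R}) (D : set T) (f : T -> R[i]) : R[i] :=
  Rintegral mu D (fun t => complex.Re (f t)) +i*
  Rintegral mu D (fun t => complex.Im (f t)).

(* A finite linear combination of indicators; see simple_on for the
   conditions on the sets. *)
Record simple_comb (T : Type) (R : realType) (V : normedModType R[i]) :=
  SimpleComb { sc_size : nat ;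
               sc_set : 'I_sc_size -> set T ;
               sc_val : 'I_sc_size -> V }.
Arguments sc_set {T R V} s i : rename.
Arguments sc_val {T R V} s i : rename.

Definition simple_on d (T : measurableType d) (R : realType)
    (V : normedModType R[i]) (mu : {measure set T -> \bar R}) (D : set T)
    (s : simple_comb T V) : Prop :=
  forall i, [/\ measurable (sc_set s i), sc_set s i `<=` D
              & (mu (sc_set s i) < +oo)%E].

Definition simple_eval (T : Type) (R : realType) (V : normedModType R[i])
    (s : simple_comb T V) (t : T) : V :=
  \sum_(i < sc_size s) (\1_(sc_set s i) t : R[i]) *: sc_val s i.

Definition simple_integral d (T : measurableType d) (R : realType)
    (V : normedModType R[i]) (mu : {measure set T -> \bar R})
    (s : simple_comb T V) : V :=
  \sum_(i < sc_size s) (fine (mu (sc_set s i)))%:C *: sc_val s i.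

(* f is Bochner integrable on D with integral v *)
Definition is_bochner_integral d (T : measurableType d) (R : realType)
    (V : normedModType R[i]) (mu : {measure set T -> \bar R}) (D : set T)
    (f : T -> V) (v : V) : Prop :=
  exists s : nat -> simple_comb T V,
    [/\ forall n, simple_on mu D (s n),
        {ae mu, forall t, D t -> simple_eval (s n) t @[n --> \oo] --> f t},
        (\int[mu]_(t in D) (rnorm (f t - simple_eval (s n) t))%:E)%E
          @[n --> \oo] --> 0%E
      & simple_integral mu (s n) @[n --> \oo] --> v].

(* The values of op outside dom are irrelevant. *)
Record unbounded_operator (R : realType) (X : normedModType R[i]) :=
  UnboundedOperator {
    dom : set X ;
    op :> X -> X ;
    dom0 : dom 0 ;
    dom_linear : forall (k : R[i]) x y, dom x -> dom y -> dom (k *: x + y) ;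
    op_linear : forall (k : R[i]) x y, dom x -> dom y ->
      op (k *: x + y) = k *: op x + op y }.

Definition closed_operator (R : realType) (X : normedModType R[i])
    (A : unbounded_operator X) : Prop :=
  closed [set p : X * X | dom A p.1 /\ p.2 = A p.1].

Definition densely_defined (R : realType) (X : normedModType R[i])
    (A : unbounded_operator X) : Prop :=
  closure (dom A) = setT.

(* C, restricted to dom A, is a bounded linear operator from D(A) with the
   graph norm to Y; its values outside dom A are irrelevant. *)
Definition graph_bounded_linear (R : realType) (X Y : normedModType R[i])
    (A : unbounded_operator X) (C : X -> Y) : Prop :=
  (forall (k : R[i]) x y, dom A x -> dom A y ->
     C (k *: x + y) = k *: C x + C y) /\
  (exists M : R, forall x, dom A x ->
     rnorm (C x) <= M * (rnorm x + rnorm (A x))).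

(* 'pinv_(fun=> 0) D f is the inverse of f : D -> f(D), extended by 0 outside
   f(D); it is only of interest here when f is a bijection from D onto X. *)
Definition resolvent (R : realType) (X : normedModType R[i])
    (A : unbounded_operator X) (lam : R[i]) : X -> X :=
  'pinv_(fun=> 0) (dom A) (fun x => lam *: x - A x).

Definition resolvent_set (R : realType) (X : normedModType R[i])
    (A : unbounded_operator X) : set R[i] :=
  [set lam | set_bij (dom A) setT (fun x => lam *: x - A x) /\
             (opnorm (resolvent A lam) < +oo)%E].

Definition spectrum (R : realType) (X : normedModType R[i])
    (A : unbounded_operator X) : set R[i] :=
  ~` resolvent_set A.

(* This says that - A, not A, is sectorial of type om. *)
Definition opp_sectorial (R : realType) (X : normedModType R[i])
    (A : unbounded_operator X) (om : R) : Prop :=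
  [/\ 0 < om < pi,
      spectrum A `<=` [set z : R[i] | sector om (- z)]
    & forall eps : R, 0 < eps ->
      (ereal_sup [set opnorm (fun x => lam *: resolvent A lam x)
                 | lam in sector (pi - om - eps)] < +oo)%E].

(* a is (a Borel representative of) an element of L^1_loc([0, +oo[); its values
   at negative times are irrelevant. *)
Definition L1loc (R : realType) (a : R -> R[i]) : Prop :=
  forall t : R,
    (@lebesgue_measure R).-integrable `[0, t]
       (fun s => (complex.Re (a s))%:E) /\
    (@lebesgue_measure R).-integrable `[0, t]
       (fun s => (complex.Im (a s))%:E).

Definition subexponential (R : realType) (a : R -> R[i]) : Prop :=
  forall eps : R, 0 < eps ->
    (\int[@lebesgue_measure R]_(t in `[0%R, +oo[)
       (expR (- (eps * t)) * cabs (a t))%:E < +oo)%E.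

Definition laplace (R : realType) (a : R -> R[i]) (lam : R[i]) : R[i] :=
  Cintegral (@lebesgue_measure R) `[0, +oo[
    (fun t => cexp (- (lam * t%:C)) * a t).

(* The derivatives are complex ones. *)
Definition regular (R : realType) (k : nat) (a : R -> R[i]) : Prop :=
  exists2 K : R, 0 < K &
    forall (n : nat) (lam : R[i]), (n <= k)%N -> 0 < complex.Re lam ->
      cabs (lam ^+ n * derive1n n (laplace a : R[i] -> R[i]^o) lam)
        <= K * cabs (laplace a lam).

(* lam^-1 (I - \hat a(lam) A)^-1, where I - \hat a(lam) A has domain dom A. *)
Definition Hop (R : realType) (X : normedModType R[i])
    (A : unbounded_operator X) (a : R -> R[i]) (lam : R[i]) (x : X) : X :=
  lam^-1 *: 'pinv_(fun=> 0) (dom A) (fun y => y - laplace a lam *: A y) x.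

Definition parabolic (R : realType) (X : normedModType R[i])
    (A : unbounded_operator X) (a : R -> R[i]) : Prop :=
  (forall lam : R[i], 0 < complex.Re lam ->
     laplace a lam != 0 /\ resolvent_set A (laplace a lam)^-1) /\
  (exists2 M : R, 0 < M &
     forall lam : R[i], 0 < complex.Re lam ->
       (opnorm (Hop A a lam) <= (M / cabs lam)%:E)%E).

(* Only the operators S t with 0 <= t are relevant. *)
Definition solution_family (R : realType) (X : normedModType R[i])
    (A : unbounded_operator X) (a : R -> R[i]) (S : R -> {linear X -> X}) :
    Prop :=
  [/\ forall t : R, 0 <= t -> continuous (S t),
      forall x, S 0 x = x,
      forall x, {within `[0, +oo[, continuous (fun t : R => S t x)},
      forall (t : R) (x : X), 0 <= t -> dom A x -> dom A (S t x) /\ A (S t x) = S t (A x)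
    & forall (t : R) (x : X), 0 <= t -> dom A x ->
        exists2 v : X,
          is_bochner_integral (@lebesgue_measure R) `[0, t]
            (fun s => a (t - s) *: A (S s x)) v
        & S t x = x + v].

Definition bounded_family (R : realType) (X : normedModType R[i])
    (S : R -> {linear X -> X}) : Prop :=
  (ereal_sup [set opnorm (S t) | t in `[0%R, +oo[%classic] < +oo)%E.

Definition finite_time_admissible (R : realType) (X Y : normedModType R[i])
    (A : unbounded_operator X) (S : R -> {linear X -> X}) (C : X -> Y) :
    Prop :=
  exists eta K : R, [/\ 0 < eta, 0 < K &
    forall (t : R) (x : X), 0 <= t -> dom A x ->
      ((\int[@lebesgue_measure R]_(r in `[0%R, t])
          (rnorm (C (S r x)) ^+ 2)%:E) `^ (2^-1)
       <= (K * expR (eta * t) * rnorm x)%:E)%E].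

Definition logplus (R : realType) (r : R) : R := Num.max (ln r) 0.

(* Main.v *)
Require Import Defs.
From HB Require Import structures.
From mathcomp Require Import all_boot all_order all_algebra complex.
From mathcomp Require Import all_classical all_reals all_analysis.
From mathcomp Require Import measurable_realfun.
From mathcomp Require Import ring lra.
Set Implicit Arguments.
Unset Strict Implicit.
Unset Printing Implicit Defensive.
Import Order.TTheory GRing.Theory Num.Theory.
Import numFieldNormedType.Exports.
Local Open Scope classical_set_scope.
Local Open Scope complex_scope.
Local Open Scope ring_scope.

(** The idea is the pointwise bound
      |C S(t) x|^2 <= N log_profile alpha t |x|^2   for t > 0, x in D(A),
    where log_profile alpha t = t^-1 (1 + log^+ (1/t))^(-2 alpha); for
    2 alpha > 1 this is integrable near 0, with the explicit primitive
    (1 - log t)^(1 - 2 alpha) / (2 alpha - 1), and it is at most 1 on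
    [1, +oo[, so the square integral over [0, t] grows at most linearly in t.

    The bound is read off the Laplace transform C H of C S, along the line
    Re lambda = 1/t.  The given estimate concerns real lambda only.  The
    1-regularity of the kernel says that the logarithmic derivative of its
    transform is O(1/|lambda|), so by Gronwall's inequality the transform does
    not vary by more than a constant factor between lambda and |lambda|
    ([laplace_chord]); with the resolvent identity and the parabolic bound on
    H this gives
      |C H(lambda)| <= const / weight alpha |lambda|   ([complex_H_bound]).
    On a vertical line this is O(|lambda|^(-1/2)) and not integrable.  The
    missing decay comes from multiplying C S by 1 - e^(-delta u), delta = 1/t:
    on the transform side this is the difference C H(lambda) -
    C H(lambda + delta), and 1-regularity makes it smaller than C H(lambda) by
    a factor delta / |lambda| ([laplace_shift], [H_difference_bound]).  At
    u = t the multiplier is the constant 1 - e^-1, so nothing is lost.  The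
    inverse Laplace integral then converges absolutely and, as |lambda| >= delta,
    the logarithm in the weight can be replaced by its value at delta.

    No integral of vector-valued functions is formed.  Everything is tested
    against real-linear functionals psi on X or Y: a norming functional for
    the vector C S(t) x turns the claim into one about a real function.  Real
    linearity suffices and is convenient, since psi (z *: y) already contains
    the real and imaginary parts of the complex factor z.  In this form
    [laplace_solution] derives the transform of S from the Volterra equation
    (convolution theorem), [observation_functional] transfers it to C S, and
    the inverse transform is [cosine_inversion_le], a one-sided inversion
    inequality proved by Poisson smoothing. *)

(** * Integrable functions on the line and Fubini's theorem *)

Definition L1 (R : realType) (f : R -> R) : Prop :=
  (@lebesgue_measure R).-integrable setT (EFin \o f).

Definition intR (R : realType) (f : R -> R) : R :=
  Rintegral (@lebesgue_measure R) setT f.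

Lemma L1_measurable (R : realType) (f : R -> R) : L1 f -> measurable_fun setT f.
Proof. by move=> /integrableP[/measurable_EFinP]. Qed.

Lemma intR_EFin (R : realType) (f : R -> R) : L1 f ->
  (\int[@lebesgue_measure R]_x (f x)%:E)%E = (intR f)%:E.
Proof. by move=> fi; rewrite fineK//; exact: integrable_fin_num. Qed.

Lemma L1_dom (R : realType) (f g : R -> R) :
  measurable_fun setT f -> L1 g -> (forall x, `|f x| <= g x) -> L1 f.
Proof.
move=> mf gi fg; apply: le_integrable gi => //; first exact/measurable_EFinP.
by move=> x _ /=; rewrite lee_fin (le_trans (fg x))// ler_norm.
Qed.

Lemma L1D (R : realType) (f g : R -> R) :
  L1 f -> L1 g -> L1 (fun x => f x + g x).
Proof.
move=> fi gi; rewrite /L1.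
by rewrite (_ : _ \o _ = (EFin \o f) \+ (EFin \o g))%E//; exact: integrableD.
Qed.

Lemma L1Z (R : realType) (k : R) (f : R -> R) :
  L1 f -> L1 (fun x => k * f x).
Proof.
move=> fi; rewrite /L1.
by rewrite (_ : _ \o _ = (fun x => k%:E * (f x)%:E))%E//; exact: integrableZl.
Qed.

Lemma L1_norm (R : realType) (f : R -> R) : L1 f -> L1 (fun x => `|f x|).
Proof. by move=> fi; apply: (integrable_norm fi). Qed.

Lemma intRD (R : realType) (f g : R -> R) : L1 f -> L1 g ->
  intR (fun x => f x + g x) = intR f + intR g.
Proof. by move=> fi gi; rewrite /intR RintegralD. Qed.

Lemma intRZ (R : realType) (k : R) (f : R -> R) : L1 f ->
  intR (fun x => k * f x) = k * intR f.
Proof. by move=> fi; rewrite /intR RintegralZl. Qed.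

Lemma le_intR (R : realType) (f g : R -> R) : L1 f -> L1 g ->
  (forall x, f x <= g x) -> intR f <= intR g.
Proof. by move=> fi gi fg; apply: le_Rintegral. Qed.

Lemma intR_le_norm (R : realType) (f g : R -> R) : L1 f -> L1 g ->
  (forall x, `|f x| <= g x) -> `|intR f| <= intR g.
Proof.
move=> fi gi fg; rewrite (le_trans (le_normr_Rintegral measurableT fi))//.
by apply: (@le_intR R (fun x => `|f x|)) => //; exact: L1_norm.
Qed.

Lemma lebesgue_pushforward_shift (R : realType) (s : R) (A : set R) :
  measurable A ->
  pushforward (@lebesgue_measure R)
    ((fun x => x + s) : _ -> measurableTypeR R) A = lebesgue_measure A.
Proof.
have mphi : measurable_fun setT
    ((fun x => x + s) : measurableTypeR R -> measurableTypeR R).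
  exact: measurable_funD.
pose phi : {mfun measurableTypeR R >-> measurableTypeR R} :=
  HB.pack ((fun x => x + s) : measurableTypeR R -> measurableTypeR R)
    (isMeasurableFun.Build _ _ _ _ _ mphi).
move=> mA; apply/esym.
apply: (@lebesgue_measure_unique R (pushforward lebesgue_measure phi)) => //.
move=> _ [[a b]] _ <-; rewrite /pushforward /=.
rewrite [X in _ = lebesgue_measure X](_ : _ =
   `]a - s, b - s]%classic); last first.
  by apply/seteqP; split => x /=; rewrite !in_itv/= ltrBlDr lerBrDr.
rewrite !lebesgue_measure_itv/= !lte_fin ltrD2r; case: ifP => // _.
by rewrite -!EFinB; congr EFin; ring.
Qed.

(** A change of variables for a measure-preserving map; it is only used for
    translations and for the reflection of the line. *)
Lemma L1_preserving (R : realType) 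
    (phi0 : measurableTypeR R -> measurableTypeR R) (f : R -> R) :
  measurable_fun setT phi0 ->
  (forall A, measurable A ->
    pushforward (@lebesgue_measure R) phi0 A = lebesgue_measure A) ->
  L1 f -> L1 (f \o phi0) /\ intR (f \o phi0) = intR f.
Proof.
move=> mphi0.
pose phi : {mfun measurableTypeR R >-> measurableTypeR R} :=
  HB.pack phi0 (isMeasurableFun.Build _ _ _ _ _ mphi0).
have mphi : measurable_fun setT phi by [].
change phi0 with (phi : _ -> _); clearbody phi => phiE fi.
have mf := L1_measurable fi.
have fphi : L1 (f \o phi).
  apply/integrableP; split.
    by apply/measurable_EFinP; exact: (measurableT_comp mf).
  have /integrableP[_] := fi; rewrite (_ : (\int[_]_(x in _) _)%E =
     (\int[lebesgue_measure]_x `|(EFin \o (f \o phi)) x|)%E) //.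
  transitivity (\int[pushforward lebesgue_measure phi]_x `|(EFin \o f) x|)%E.
    by apply: eq_measure_integral => A mA _; rewrite -[LHS]phiE.
  rewrite ge0_integral_pushforward//.
  by apply: measurableT_comp => //; exact/measurable_EFinP.
split=> //; congr fine.
transitivity (\int[pushforward lebesgue_measure phi]_x (EFin \o f) x)%E.
  by rewrite integral_pushforward//; exact/measurable_EFinP.
by apply: eq_measure_integral => A mA _; rewrite -[RHS]phiE.
Qed.

Lemma L1_shift (R : realType) (s : R) (f : R -> R) : L1 f ->
  L1 (fun t => f (t + s)) /\ intR (fun t => f (t + s)) = intR f.
Proof.
apply: (@L1_preserving R (fun x => x + s)); first exact: measurable_funD.
by move=> A mA; exact: lebesgue_pushforward_shift.
Qed.

Lemma L1_reflect (R : realType) (f : R -> R) : L1 f ->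
  L1 (fun t => f (- t)) /\ intR (fun t => f (- t)) = intR f.
Proof.
apply: (@L1_preserving R (fun x => - x)); first exact: oppr_measurable.
by move=> A mA; exact: lebesgue_measureN.
Qed.

(** Stated with finite integrals: the sections are assumed integrable for every
    value of the other variable, so that all inner integrals are genuine real
    numbers and no exceptional null set has to be carried along.  The bound h
    on the inner integrals of |F| gives integrability on the plane by Tonelli. *)
Lemma fubini_intR (R : realType) (F : R * R -> R) (h : R -> R) :
  measurable_fun setT F ->
  (forall x, L1 (fun y => F (x, y))) -> (forall y, L1 (fun x => F (x, y))) ->
  L1 h -> (forall x, intR (fun y => `|F (x, y)|) <= h x) ->
  [/\ L1 (fun x => intR (fun y => F (x, y))),
      L1 (fun y => intR (fun x => F (x, y)))
    & intR (fun x => intR (fun y => F (x, y))) =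
      intR (fun y => intR (fun x => F (x, y)))].
Proof.
move=> mF Fx Fy hi Fh.
pose mu := @lebesgue_measure R.
have mEF : measurable_fun setT (EFin \o F) by exact/measurable_EFinP.
have iF : (mu \x mu)%E.-integrable setT (EFin \o F).
  apply/(integrable12ltyP mu mu mEF).
  apply: (@le_lt_trans _ _ (\int[mu]_x (h x)%:E)%E); last first.
    exact: integrable_lty hi.
  apply: ge0_le_integral => //.
  - by move=> x _; exact: integral_ge0.
  - apply: (@measurable_fun_fubini_tonelli_F _ _ _ _ _ mu (abse \o (EFin \o F))) => //=.
    exact: measurableT_comp.
  - exact: measurable_int hi.
  - move=> x _; rewrite [leLHS](intR_EFin (L1_norm (Fx x))) lee_fin.
    exact: Fh.
have E1 : (fun x => (intR (fun y => F (x, y)))%:E) =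
          (fun x => \int[mu]_y (EFin \o F) (x, y))%E.
  by apply/funext => x; rewrite -intR_EFin.
have E2 : (fun y => (intR (fun x => F (x, y)))%:E) =
          (fun y => \int[mu]_x (EFin \o F) (x, y))%E.
  by apply/funext => x; rewrite -intR_EFin.
split.
- rewrite /L1 (_ : _ \o _ = (fun x => \int[mu]_y (EFin \o F) (x, y))%E) //.
  exact: integrable_fubini_F.
- rewrite /L1 (_ : _ \o _ = (fun y => \int[mu]_x (EFin \o F) (x, y))%E) //.
  have mFs : measurable_fun setT (EFin \o (fun z : R * R => F (z.2, z.1))).
    apply/measurable_EFinP; apply: (measurableT_comp mF).
    by apply/measurable_fun_pair => /=; [exact: measurable_snd|
      exact: measurable_fst].
  have iFs : (mu \x mu)%E.-integrable setT (EFin \o (fun z : R * R => F (z.2, z.1))).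
    apply/(integrable12ltyP mu mu mFs).
    exact: ((integrable21ltyP mu mu mEF).1 iF).
  exact: (integrable_fubini_F iFs).
- rewrite /intR /Rintegral; congr fine.
  under eq_integral do rewrite -[(fine _)]/(intR _) (congr1 (fun f => f _) E1).
  rewrite (Fubini iF); apply: eq_integral => y _.
  by rewrite -(congr1 (fun f => f y) E2).
Qed.

(** The situation of the inversion formula: an integrable product p(x) q(y)
    times a bounded oscillating kernel k. *)
Lemma fubini_tensor (R : realType) (k : R * R -> R) (p q : R -> R) :
  L1 p -> L1 q -> measurable_fun setT k -> (forall z, `|k z| <= 1) ->
  [/\ forall x, L1 (fun y => p x * q y * k (x, y)),
      forall y, L1 (fun x => p x * q y * k (x, y)),
      L1 (fun x => intR (fun y => p x * q y * k (x, y))),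
      L1 (fun y => intR (fun x => p x * q y * k (x, y)))
    & intR (fun x => intR (fun y => p x * q y * k (x, y))) =
      intR (fun y => intR (fun x => p x * q y * k (x, y)))].
Proof.
move=> ip iq mk k1.
have mp := L1_measurable ip; have mq := L1_measurable iq.
have mF : measurable_fun setT (fun z : R * R => p z.1 * q z.2 * k z).
  apply: measurable_funM => //; apply: measurable_funM.
    exact: (measurableT_comp mp measurable_fst).
  exact: (measurableT_comp mq measurable_snd).
have k1' a z : `|a * k z| <= `|a| by rewrite normrM ler_piMr.
have Fx x : L1 (fun y => p x * q y * k (x, y)).
  apply: (@L1_dom _ _ (fun y => `|p x| * `|q y|)).
  - exact: (measurableT_comp mF (measurable_pair1 x)).
  - exact/L1Z/L1_norm.
  - by move=> y; rewrite (le_trans (k1' _ _))// normrM.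
have Fy y : L1 (fun x => p x * q y * k (x, y)).
  apply: (@L1_dom _ _ (fun x => `|q y| * `|p x|)).
  - exact: (measurableT_comp mF (measurable_pair2 y)).
  - exact/L1Z/L1_norm.
  - by move=> x; rewrite (le_trans (k1' _ _))// normrM mulrC.
have [||//] := @fubini_intR R _ (fun x => intR (fun y => `|q y|) * `|p x|) mF Fx Fy.
  exact/L1Z/L1_norm.
move=> x; rewrite mulrC -intRZ; last exact: L1_norm.
apply: le_intR; [exact: (L1_norm (Fx x))|exact/L1Z/L1_norm|].
by move=> y; rewrite (le_trans (k1' _ _))// normrM.
Qed.

(** The integral of a convolution is the product of the integrals.  Boundedness
    of p makes s |-> b(t - s) p(s) integrable for every t, not just almost
    every t. *)
Lemma convolution_intR (R : realType) (b p : R -> R) (B : R) :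
  L1 b -> L1 p -> (forall s, `|p s| <= B) ->
  [/\ forall t, L1 (fun s => b (t - s) * p s),
      L1 (fun t => intR (fun s => b (t - s) * p s))
    & intR (fun t => intR (fun s => b (t - s) * p s)) = intR b * intR p].
Proof.
move=> ib ip pB.
have mb := L1_measurable ib; have mp := L1_measurable ip.
have mF : measurable_fun setT (fun z : R * R => b (z.2 - z.1) * p z.1).
  apply: measurable_funM; last exact: (measurableT_comp mp measurable_fst).
  apply: (measurableT_comp mb); apply: measurable_funB.
    exact: measurable_snd.
  exact: measurable_fst.
have Fs s : L1 (fun t => b (t - s) * p s).
  have /L1Z : L1 (fun t => b (t - s)) by have [] := L1_shift (- s) ib.
  by move=> /(_ (p s)); under [in X in X -> _]eq_fun do rewrite mulrC.
have bt t : L1 (fun s => b (t - s)).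
  have [+ _] := L1_shift t ib; move=> /L1_reflect[+ _].
  by under [in X in X -> _]eq_fun do rewrite addrC.
have Ft t : L1 (fun s => b (t - s) * p s).
  apply: (@L1_dom _ _ (fun s => B * `|b (t - s)|)).
  - exact: (measurableT_comp mF (measurable_pair2 t)).
  - exact/L1Z/L1_norm.
  - by move=> s; rewrite normrM mulrC ler_wpM2r.
have [|s|_ iC <-] := @fubini_intR R _ (fun s => intR (fun t => `|b t|) * `|p s|) mF Fs Ft.
- exact/L1Z/L1_norm.
- move=> /=; under [leLHS]eq_Rintegral do rewrite normrM mulrC.
  rewrite -/(intR _) intRZ; last first.
    by apply: L1_norm; have [] := L1_shift (- s) ib.
  by rewrite mulrC (L1_shift (- s) (L1_norm ib)).2 lexx.
- split=> //=; rewrite -intRZ//; congr intR; apply/funext => s.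
  rewrite -[in RHS](L1_shift (- s) ib).2 [RHS]mulrC.
  rewrite -intRZ; last by have [] := L1_shift (- s) ib.
  by congr intR; apply/funext => t; rewrite mulrC.
Qed.

(** * Integrals over the half-line *)

(** Functions of time t >= 0 are extended by 0, so that translations,
    convolutions and Fubini's theorem can be used on the whole line. *)
Definition half (R : realType) (f : R -> R) (t : R) : R :=
  if 0 <= t then f t else 0.

Lemma half_restrict (R : realType) (f : R -> R) : f \_ `[0, +oo[ = half f.
Proof.
apply/funext => t; rewrite /half patchE; case: ifPn => h; first by
  move: h; rewrite inE/= in_itv/= andbT => ->.
by move: h; rewrite notin_setE/= in_itv/= andbT => /negP/negbTE ->.
Qed.

Lemma half_L1 (R : realType) (f : R -> R) :
  (@lebesgue_measure R).-integrable `[0, +oo[ (EFin \o f) <-> L1 (half f).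
Proof.
rewrite -half_restrict /L1 -restrict_EFin.
by apply: integrable_mkcond.
Qed.

Lemma half_measurable (R : realType) (f : R -> R) :
  measurable_fun (`[0, +oo[%classic : set R) f <-> measurable_fun setT (half f).
Proof.
by rewrite -half_restrict; apply: measurable_restrictT; exact: measurable_itv.
Qed.

Lemma half_int (R : realType) (f : R -> R) :
  Rintegral (@lebesgue_measure R) `[0, +oo[ f = intR (half f).
Proof. by rewrite Rintegral_mkcond half_restrict. Qed.

Lemma is_derive_add (R : realType) (f g : R -> R) (x a b : R) :
  is_derive x 1 f a -> is_derive x 1 g b ->
  is_derive x 1 (fun y => f y + g y) (a + b).
Proof. by move=> fa gb; exact: is_deriveD. Qed.

Lemma is_derive_mul (R : realType) (f g : R -> R) (x a b : R) :
  is_derive x 1 f a -> is_derive x 1 g b ->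
  is_derive x 1 (fun y => f y * g y) (a * g x + f x * b).
Proof.
move=> fa gb; have := is_deriveM fa gb.
by rewrite /GRing.scale/= addrC (mulrC (g x)).
Qed.

Lemma is_derive_linear (R : realType) (c x : R) :
  is_derive x 1 (fun y => c * y) c.
Proof.
have := is_derive_mul (is_derive_cst c x 1) (is_derive_id x 1).
by rewrite mul0r add0r mulr1.
Qed.

Lemma derivable_continuous (R : realType) (f df : R -> R) :
  (forall x : R, is_derive x 1 f (df x)) -> continuous f.
Proof.
move=> fd x; apply: differentiable_continuous; apply/derivable1_diffP.
by have [] := fd x.
Qed.

Lemma is_derive_expM (R : realType) (c t : R) :
  is_derive t 1 (fun t => expR (c * t)) (c * expR (c * t)).
Proof.
by rewrite mulrC; apply: is_derive1_comp; exact: is_derive_linear.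
Qed.

Lemma expR_cvg0 (R : realType) (c : R) : 0 < c ->
  expR (- c * t) @[t --> +oo] --> 0.
Proof.
move=> c0; apply: (@cvg_trans _ ((expR \o -%R) (c * t) @[t --> +oo])).
  by apply: near_eq_cvg; near=> t => /=; rewrite mulNr.
apply: cvg_comp (@cvgr_expR R).
by apply/cvgryPge => A; near=> t; rewrite mulrC -ler_pdivrMr.
Unshelve. all: by end_near. Qed.

(** A nonnegative integrand is integrable as soon as its primitive has a limit
    at infinity. *)
Lemma ge0_FTC_half (R : realType) (f F : R -> R) :
  (forall x, 0 <= x -> 0 <= f x) -> {within `[0, +oo[, continuous f} ->
  (forall x : R, 0 <= x -> is_derive x 1 F (f x)) -> F x @[x --> +oo] --> 0 ->
  L1 (half f) /\ intR (half f) = - F 0.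
Proof.
move=> f0 cf dF F0.
have E : (\int[@lebesgue_measure R]_(x in `[0%R, +oo[) (f x)%:E = (- F 0)%:E)%E.
  rewrite (@ge0_continuous_FTC2y _ f F 0 0)//.
  - by rewrite sub0e.
  - by move=> x x0; have [] := dF x (ltW x0).
  - apply: cvg_at_right_filter; apply: differentiable_continuous.
    by apply/derivable1_diffP; have [] := dF 0 (lexx 0).
  - move=> x; rewrite in_itv/= andbT => x0.
    by rewrite derive1E; have [_ ->] := dF x (ltW x0).
split; last by rewrite -half_int /Rintegral E.
apply/half_L1/integrableP; split.
  apply/measurable_EFinP; exact: subspace_continuous_measurable_fun.
apply: (@le_lt_trans _ _ (- F 0)%:E); last exact: ltry.
rewrite -E le_eqVlt; apply/orP; left; apply/eqP.
apply: eq_integral => x; rewrite inE/= in_itv/= andbT => x0.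
by rewrite ger0_norm// f0.
Qed.

Lemma exp_half (R : realType) (c : R) : 0 < c ->
  L1 (half (fun t => expR (- c * t))) /\
  intR (half (fun t => expR (- c * t))) = c^-1.
Proof.
move=> c0.
have [] := @ge0_FTC_half R (fun t => expR (- c * t))
   (fun t => - c^-1 * expR (- c * t)).
- by move=> x _; exact: expR_ge0.
- apply: continuous_subspaceT.
  exact: (derivable_continuous (is_derive_expM (- c))).
- move=> x _; have := is_derive_mul (is_derive_cst (- c^-1) x 1) (is_derive_expM (- c) x).
  by rewrite mul0r add0r mulrA mulrNN mulVf ?gt_eqF// mul1r.
- by rewrite -[X in _ --> X](mulr0 (- c^-1)); apply: cvgMr; exact: expR_cvg0.
- by rewrite !mulr0 expR0 mulr1 opprK.
Qed.

(** Adding K e^(-c x) makes the integrand nonnegative and reduces the claim to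
    the nonnegative case, without a limit of integrals over [0, n]. *)
Lemma FTC_half (R : realType) (f F : R -> R) (c K : R) : 0 < c ->
  continuous f -> (forall x : R, is_derive x 1 F (f x)) ->
  (forall x, `|f x| <= K * expR (- c * x)) ->
  F x @[x --> +oo] --> 0 ->
  L1 (half f) /\ intR (half f) = - F 0.
Proof.
move=> c0 cf dF fK F0.
pose e (t : R) :=  expR (- c * t).
have [ie Ie] := exp_half c0.
have de (x : R) : is_derive x 1 (fun t => - (K / c) * e t) (K * e x).
  have := is_derive_mul (is_derive_cst (- (K / c)) x 1) (is_derive_expM (- c) x).
  by rewrite mul0r add0r mulrA mulrNN divfK ?gt_eqF.
have [|||] := @ge0_FTC_half R (fun x => f x + K * e x)
    (fun x => F x + - (K / c) * e x).
- by move=> x _; have := fK x; rewrite ler_norml => /andP[]; rewrite /e; lra.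
- apply: continuous_subspaceT => x; apply: cvgD; first exact: cf.
  apply: cvgM; first exact: cvg_cst.
  exact: (derivable_continuous (is_derive_expM (- c))).
- rewrite -[X in _ --> X]addr0; apply: cvgD => //.
  by rewrite -[X in _ --> X](mulr0 (- (K / c))); apply: cvgMr; exact: expR_cvg0.
move=> i1 I1.
have fE : half f = (fun t => half (fun x => f x + K * e x) t + - K * half e t).
  by apply/funext => t; rewrite /half; case: ifP => _; rewrite ?mulr0 ?addr0//; ring.
rewrite fE; split; first by apply: L1D => //; exact: L1Z.
rewrite intRD//; last exact: L1Z.
by rewrite intRZ// I1 Ie /e mulr0 expR0; ring.
Qed.

(** The integrand is the derivative of e^(-c t) (p cos bt + q sin bt).  Solving
    for p and q gives the transforms of cos and sin below. *)
Lemma trig_exp_half (R : realType) (c b p q : R) : 0 < c ->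
  let E := fun t : R => expR (- c * t) *
     ((q * b - c * p) * cos (b * t) + (- (p * b) - c * q) * sin (b * t)) in
  L1 (half E) /\ intR (half E) = - p.
Proof.
move=> c0 E.
pose F (t : R) := expR (- c * t) * (p * cos (b * t) + q * sin (b * t)).
have dcos (x : R) : is_derive x 1 (fun t => cos (b * t)) (- sin (b * x) * b).
  by apply: is_derive1_comp; exact: is_derive_linear.
have dsin (x : R) : is_derive x 1 (fun t => sin (b * t)) (cos (b * x) * b).
  by apply: is_derive1_comp; exact: is_derive_linear.
have dlin (u v x : R) : is_derive x 1 (fun t => u * cos (b * t) + v * sin (b * t))
    (u * (- sin (b * x) * b) + v * (cos (b * x) * b)).
  exact: is_derive_add.
have dF (u v x : R) : is_derive x 1
   (fun t => expR (- c * t) * (u * cos (b * t) + v * sin (b * t)))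
   (expR (- c * x) * ((v * b - c * u) * cos (b * x) + (- (u * b) - c * v) * sin (b * x))).
  have h := is_derive_mul (is_derive_expM (- c) x) (dlin u v x).
  by apply: (is_derive_eq h); ring.
have Ebd (u v x : R) : `|expR (- c * x) * (u * cos (b * x) + v * sin (b * x))|
   <= (`|u| + `|v|) * expR (- c * x).
  rewrite normrM (ger0_norm (expR_ge0 _)) mulrC ler_wpM2r ?expR_ge0//.
  rewrite (le_trans (ler_normD _ _))// !normrM lerD//.
    by rewrite ler_piMr// ler_norml cos_geN1 cos_le1.
  by rewrite ler_piMr// ler_norml sin_geN1 sin_le1.
have F0 : F x @[x --> +oo] --> 0.
  have K0 : (`|p| + `|q|) * expR (- c * x) @[x --> +oo] --> 0.
    by rewrite -[X in _ --> X](mulr0 (`|p| + `|q|)); apply: cvgMr; exact: expR_cvg0.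
  apply: (squeeze_cvgr _ _ K0); last first.
    by rewrite -[X in _ --> X]oppr0; exact: (cvgN K0).
  by apply: nearW => x /=; rewrite -ler_norml; exact: Ebd.
have cE : continuous E.
  by apply: derivable_continuous => x; exact: dF.
have [i ->] := @FTC_half R E F c _ c0 cE (dF p q) (Ebd _ _) F0.
by split=> //; rewrite /F !mulr0 expR0 cos0 sin0 mulr0 addr0 mul1r mulr1.
Qed.

Lemma cos_exp_half (R : realType) (c b : R) : 0 < c ->
  L1 (half (fun t => expR (- c * t) * cos (b * t))) /\
  intR (half (fun t => expR (- c * t) * cos (b * t))) = c / (c ^+ 2 + b ^+ 2).
Proof.
move=> c0; have d0 : c ^+ 2 + b ^+ 2 != 0.
  by rewrite gt_eqF// ltr_wpDr ?sqr_ge0 ?exprn_gt0.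
have [] := trig_exp_half b (- (c / (c ^+ 2 + b ^+ 2))) (b / (c ^+ 2 + b ^+ 2)) c0.
set f := (fun t : R => _); rewrite (_ : f = fun t => expR (- c * t) * cos (b * t)).
  by rewrite opprK.
by apply/funext => t; rewrite /f; congr (_ * _); field.
Qed.

Lemma sin_exp_half (R : realType) (c b : R) : 0 < c ->
  L1 (half (fun t => expR (- c * t) * sin (b * t))) /\
  intR (half (fun t => expR (- c * t) * sin (b * t))) = b / (c ^+ 2 + b ^+ 2).
Proof.
move=> c0; have d0 : c ^+ 2 + b ^+ 2 != 0.
  by rewrite gt_eqF// ltr_wpDr ?sqr_ge0 ?exprn_gt0.
have [] := trig_exp_half b (- (b / (c ^+ 2 + b ^+ 2))) (- (c / (c ^+ 2 + b ^+ 2))) c0.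
set f := (fun t : R => _); rewrite (_ : f = fun t => expR (- c * t) * sin (b * t)).
  by rewrite opprK.
by apply/funext => t; rewrite /f; congr (_ * _); field.
Qed.

(** * Poisson smoothing and an inversion inequality *)

Lemma intR_indic_itv (R : realType) (x y : R) : x <= y ->
  L1 (\1_(`[x, y]%classic : set R)) /\
  intR (\1_(`[x, y]%classic : set R)) = y - x.
Proof.
move=> xy; split; first exact: (@integrable_indic_itv R x y true false).
rewrite /intR /Rintegral integral_indic// setIT.
transitivity (fine (y - x)%:E) => //; congr fine.
apply: (etrans (lebesgue_measure_itv `[x, y])).
by rewrite /= lte_fin; case: ltgtP xy => // -> _; rewrite subrr.
Qed.

Lemma poisson_ge (R : realType) (eps x : R) : 0 < eps -> `|x| <= eps ->
  (2 * eps)^-1 <= eps / (eps ^+ 2 + x ^+ 2).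
Proof.
move=> e0 xe; have x2 : x ^+ 2 <= eps ^+ 2.
  by rewrite -(real_normK (num_real x)) ler_pXn2r// nnegrE ltW.
have d0 : 0 < eps ^+ 2 + x ^+ 2 by rewrite ltr_wpDr ?sqr_ge0 ?exprn_gt0.
rewrite ler_pdivlMr// mulrC ler_pdivrMr ?mulr_gt0//.
by move: x2; rewrite !expr2; nra.
Qed.

Lemma poisson_le (R : realType) (eps rho x : R) : 0 < eps -> 0 < rho ->
  rho <= `|x| -> eps / (eps ^+ 2 + x ^+ 2) <= eps / rho ^+ 2.
Proof.
move=> e0 r0 xe; have x2 : rho ^+ 2 <= x ^+ 2.
  by rewrite -(real_normK (num_real x)) ler_pXn2r// nnegrE ?normr_ge0// ltW.
apply: ler_wpM2l; first exact: ltW.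
rewrite lef_pV2 ?posrE ?exprn_gt0//.
  by rewrite (le_trans x2)// lerDr sqr_ge0.
by rewrite ltr_wpDr ?sqr_ge0 ?exprn_gt0.
Qed.

(** Abel summation of the cosine transform of H at t: the weight e^(-eps s) turns
    the inverse transform into the convolution of H with the Poisson kernel
    eps / (eps^2 + x^2), by Fubini and the transform of cos. *)
Lemma poisson_smoothing (R : realType) (H : R -> R) (t eps : R) :
  0 < eps -> L1 H ->
  [/\ L1 (fun u => H u * (eps / (eps ^+ 2 + (t - u) ^+ 2))),
      L1 (half (fun s => expR (- eps * s) *
        intR (fun u => H u * cos (s * (t - u)))))
    & intR (half (fun s => expR (- eps * s) *
        intR (fun u => H u * cos (s * (t - u))))) =
      intR (fun u => H u * (eps / (eps ^+ 2 + (t - u) ^+ 2)))].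
Proof.
move=> e0 iH.
pose p := half (fun s : R => expR (- eps * s)).
pose k (z : R * R) := cos (z.1 * (t - z.2)).
have mk : measurable_fun setT k.
  apply: (@measurableT_comp _ _ _ _ _ _ (@cos R)).
    exact: (continuous_measurable_fun (@continuous_cos R)).
  apply: measurable_funM; first exact: measurable_fst.
  by apply: measurable_funB => //; exact: measurable_snd.
have k1 z : `|k z| <= 1 by rewrite ler_norml cos_geN1 cos_le1.
have ip : L1 p by have [] := exp_half e0.
have [Fs Fu iS iu E] := fubini_tensor ip iH mk k1.
have Eu u : intR (fun s => p s * H u * k (s, u)) =
    H u * (eps / (eps ^+ 2 + (t - u) ^+ 2)).
  have [ic <-] := cos_exp_half (t - u) e0.
  rewrite -intRZ//; congr intR; apply/funext => s.
  rewrite /p /half/= /k/=; case: ifP => _; last by rewrite !mul0r mulr0.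
  by rewrite [s * _]mulrC; ring.
have Hc s : L1 (fun u => H u * cos (s * (t - u))).
  apply: (L1_dom _ (L1_norm iH)).
    apply: measurable_funM; first exact: L1_measurable.
    exact: (measurableT_comp mk (measurable_pair1 s)).
  by move=> u; rewrite normrM ler_piMr// ler_norml cos_geN1 cos_le1.
have Es : half (fun s => expR (- eps * s) *
    intR (fun u => H u * cos (s * (t - u)))) =
    (fun s => intR (fun u => p s * H u * k (s, u))).
  apply/funext => s; rewrite /half; case: ifPn => s0; last first.
    rewrite (_ : (fun u => _) = cst 0) ?[RHS]Rintegral_cst ?mul0r//.
    by apply/funext => u; rewrite /p /half (negbTE s0) !mul0r.
  rewrite -intRZ//; congr intR; apply/funext => u.
  by rewrite /p /half s0 /k/= mulrA.
split; first by under [X in L1 X]eq_fun do rewrite -Eu.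
  by rewrite Es.
by rewrite Es E; congr intR; apply/funext => u; exact: Eu.
Qed.

(** A continuous integrable function is bounded at t by the L^1 norm of its
    cosine transform centred at t.  Only an inequality up to a constant is
    needed, so the total mass of the Poisson kernel is not computed: it has
    mass at least 1 on |x| <= eps, where H is at least H(t)/2, and off a
    neighbourhood of 0 it is O(eps). *)
Lemma cosine_inversion_le (R : realType) (H G : R -> R) (t : R) :
  L1 H -> {for t, continuous H} -> L1 (half G) ->
  (forall s, 0 <= s -> `|intR (fun u => H u * cos (s * (t - u)))| <= G s) ->
  H t <= 2 * intR (half G).
Proof.
move=> iH cH iG HG.
have I0 : 0 <= intR (half G).
  apply: Rintegral_ge0 => s _; rewrite /half; case: ifP => // s0.
  by rewrite (le_trans _ (HG s s0)).
have [Ht0|Ht0] := leP (H t) 0; first by rewrite (le_trans Ht0)// mulr_ge0.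
have [rho rho0 Hrho] : exists2 rho : R, 0 < rho &
    forall u, `|t - u| <= rho -> H t / 2 <= H u.
  have : \forall u \near t, `|H t - H u| < H t / 2.
    by move/cvgrPdist_lt : cH; apply; rewrite divr_gt0.
  move=> /nbhs_ballP[r /= r0 hr]; exists (r / 2); first by rewrite divr_gt0.
  move=> u tu; have /hr /= : ball t r u.
    by rewrite /ball/= (le_lt_trans tu)// ltr_pdivrMr// ltr_pMr// ltr1n.
  by rewrite ltr_norml => /andP[_]; lra.
apply/ler_addgt0Pr => e e0.
pose N := intR (fun u => `|H u|).
have N0 : 0 <= N by apply: Rintegral_ge0.
(* The width eps is chosen so that the tail of the kernel costs at most e. *)
pose eps := Num.min rho (e * rho ^+ 2 / (2 * (N + 1))).
have eps0 : 0 < eps.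
  by rewrite /eps lt_min rho0/= divr_gt0// ?mulr_gt0// ?exprn_gt0// ltr_wpDl.
have epsr : eps <= rho by rewrite /eps ge_min lexx.
have epsN : 2 * (eps / rho ^+ 2 * N) <= e.
  have : eps <= e * rho ^+ 2 / (2 * (N + 1)) by rewrite /eps ge_min lexx orbT.
  rewrite ler_pdivlMr ?mulr_gt0// ?ltr_wpDl// => h.
  rewrite [X in 2 * X]mulrAC mulrA ler_pdivrMr ?exprn_gt0//.
  by apply: le_trans h; nra.
have [iP iS EP] := poisson_smoothing t eps0 iH.
have upper : intR (fun u => H u * (eps / (eps ^+ 2 + (t - u) ^+ 2)))
    <= intR (half G).
  rewrite -EP; apply: le_trans (ler_norm _) _.
  apply: intR_le_norm => // s.
  rewrite /half; case: ifPn => s0; last by rewrite normr0.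
  rewrite normrM ger0_norm ?expR_ge0// -[leRHS]mul1r ler_pM ?expR_ge0//.
    by rewrite -expR0 ler_expR mulNr oppr_le0 mulr_ge0// ltW.
  exact: HG.
have [i1 E1] : L1 (\1_(`[t - eps, t + eps]%classic : set R)) /\
    intR (\1_(`[t - eps, t + eps]%classic : set R)) = 2 * eps.
  have tt : t - eps <= t + eps by lra.
  by have [i ->] := intR_indic_itv tt; split=> //; ring.
have lower : H t / 2 - eps / rho ^+ 2 * N <=
    intR (fun u => H u * (eps / (eps ^+ 2 + (t - u) ^+ 2))).
  have -> : H t / 2 - eps / rho ^+ 2 * N = intR (fun u =>
      H t / 2 / (2 * eps) * \1_(`[t - eps, t + eps]%classic : set R) u +
      - (eps / rho ^+ 2) * `|H u|).
    rewrite intRD; [|exact: L1Z|exact/L1Z/L1_norm].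
    rewrite !intRZ; [|exact: L1_norm|by []].
    by rewrite E1 mulfVK ?mulNr// gt_eqF// mulr_gt0.
  apply: le_intR => //; first by apply: L1D; [exact: L1Z|exact/L1Z/L1_norm].
  move=> u.
  have P0 : 0 < eps / (eps ^+ 2 + (t - u) ^+ 2).
    by rewrite divr_gt0// ltr_wpDr ?sqr_ge0 ?exprn_gt0.
  have Hn : 0 <= eps / rho ^+ 2 * `|H u|.
    by rewrite mulr_ge0// divr_ge0 ?exprn_ge0 ?ltW.
  rewrite indicE; case: (boolP (u \in _)) => [|]; rewrite ?inE ?notin_setE/=.
    rewrite in_itv/= => /andP[tu1 tu2].
    have tu : `|t - u| <= eps by rewrite ler_norml; lra.
    have Hu := Hrho u (le_trans tu epsr).
    have := poisson_ge eps0 tu; set P := _ / _ in P0 *.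
    rewrite mulr1 mulNr => hP.
    apply: (@le_trans _ _ (H t / 2 * P)); last by rewrite (ler_wpM2r (ltW P0)).
    by rewrite lerBlDr ler_wpDr// ler_wpM2l// divr_ge0// ltW.
  move=> _; rewrite mulr0 add0r mulNr.
  have [tu|tu] := leP `|t - u| rho.
    apply: (@le_trans _ _ 0); first by rewrite oppr_le0.
    by rewrite mulr_ge0 ?(ltW P0)// (le_trans _ (Hrho u tu))// divr_ge0// ltW.
  have := poisson_le eps0 rho0 (ltW tu); set P := _ / _ in P0 * => hP.
  have : `|H u * P| <= eps / rho ^+ 2 * `|H u|.
    by rewrite normrM mulrC (gtr0_norm P0) ler_wpM2r.
  by rewrite ler_norml => /andP[].
by lra.
Qed.

(** * Moduli, norms and norming functionals *)

Lemma cabs_normE (R : realType) (z : R[i]) : `|z| = (cabs z)%:C.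
Proof. by rewrite /cabs normc_def. Qed.

Lemma rnorm_normE (R : realType) (V : normedModType R[i]) (x : V) :
  `|x| = (rnorm x)%:C.
Proof. by rewrite /rnorm RRe_real// normr_real. Qed.

Lemma cabsE (R : realType) (z : R[i]) :
  cabs z = Num.sqrt (complex.Re z ^+ 2 + complex.Im z ^+ 2).
Proof. by rewrite /cabs normc_def. Qed.

Lemma cabs_ge0 (R : realType) (z : R[i]) : 0 <= cabs z.
Proof. by rewrite cabsE sqrtr_ge0. Qed.

Lemma sqr_cabs (R : realType) (z : R[i]) :
  cabs z ^+ 2 = complex.Re z ^+ 2 + complex.Im z ^+ 2.
Proof. by rewrite cabsE sqr_sqrtr// addr_ge0// sqr_ge0. Qed.

Lemma cabsM (R : realType) (z w : R[i]) : cabs (z * w) = cabs z * cabs w.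
Proof. by apply: complexI; rewrite rmorphM/= -!cabs_normE normrM. Qed.

Lemma cabsV (R : realType) (z : R[i]) : cabs z^-1 = (cabs z)^-1.
Proof. by apply: complexI; rewrite fmorphV/= -!cabs_normE normfV. Qed.

Lemma cabsN (R : realType) (z : R[i]) : cabs (- z) = cabs z.
Proof. by apply: complexI; rewrite -!cabs_normE normrN. Qed.

Lemma cabs_eq0 (R : realType) (z : R[i]) : (cabs z == 0) = (z == 0).
Proof. by rewrite -(inj_eq (@complexI R)) -cabs_normE normr_eq0. Qed.

Lemma cabs_gt0 (R : realType) (z : R[i]) : (0 < cabs z) = (z != 0).
Proof. by rewrite lt_def cabs_eq0 cabs_ge0 andbT. Qed.

Lemma ler_cabsD (R : realType) (z w : R[i]) : cabs (z + w) <= cabs z + cabs w.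
Proof. by rewrite -lecR rmorphD/= -!cabs_normE ler_normD. Qed.

Lemma ler_cabsB (R : realType) (z w : R[i]) : cabs (z - w) <= cabs z + cabs w.
Proof. by rewrite (le_trans (ler_cabsD _ _))// cabsN. Qed.

Lemma cabs_real (R : realType) (r : R) : cabs r%:C = `|r|.
Proof. by rewrite cabsE /= expr0n addr0 sqrtr_sqr. Qed.

Lemma Re_le_cabs (R : realType) (z : R[i]) : `|complex.Re z| <= cabs z.
Proof.
by rewrite -(ler_pXn2r (n := 2))// ?nnegrE ?cabs_ge0// sqr_cabs
  real_normK ?num_real// lerDl sqr_ge0.
Qed.

Lemma Im_le_cabs (R : realType) (z : R[i]) : `|complex.Im z| <= cabs z.
Proof.
by rewrite -(ler_pXn2r (n := 2))// ?nnegrE ?cabs_ge0// sqr_cabs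
  real_normK ?num_real// lerDr sqr_ge0.
Qed.

Lemma cabs_le_ReIm (R : realType) (z : R[i]) :
  cabs z <= `|complex.Re z| + `|complex.Im z|.
Proof.
rewrite -(ler_pXn2r (n := 2))// ?nnegrE ?cabs_ge0 ?addr_ge0// sqr_cabs.
by rewrite sqrrD !real_normK ?num_real// addrAC lerDl mulrn_wge0// mulr_ge0.
Qed.

Lemma rnorm_ge0 (R : realType) (V : normedModType R[i]) (x : V) : 0 <= rnorm x.
Proof. by rewrite -lecR -rnorm_normE normr_ge0. Qed.

Lemma rnorm0 (R : realType) (V : normedModType R[i]) : rnorm (0 : V) = 0.
Proof. by rewrite /rnorm normr0. Qed.

Lemma rnorm_eq0 (R : realType) (V : normedModType R[i]) (x : V) :
  rnorm x = 0 -> x = 0.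
Proof. by move=> x0; apply/eqP; rewrite -normr_eq0 rnorm_normE x0. Qed.

Lemma ler_rnormD (R : realType) (V : normedModType R[i]) (x y : V) :
  rnorm (x + y) <= rnorm x + rnorm y.
Proof. by rewrite -lecR rmorphD/= -!rnorm_normE ler_normD. Qed.

Lemma rnormZ (R : realType) (V : normedModType R[i]) (k : R[i]) (x : V) :
  rnorm (k *: x) = cabs k * rnorm x.
Proof.
by apply: complexI; rewrite rmorphM/= -!rnorm_normE -cabs_normE normrZ.
Qed.

Lemma rnormN (R : realType) (V : normedModType R[i]) (x : V) :
  rnorm (- x) = rnorm x.
Proof. by rewrite /rnorm normrN. Qed.

Lemma ler_rnormB (R : realType) (V : normedModType R[i]) (x y : V) :
  rnorm (x - y) <= rnorm x + rnorm y.
Proof. by rewrite (le_trans (ler_rnormD _ _))// rnormN. Qed.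

Lemma rnormZr (R : realType) (V : normedModType R[i]) (a : R) (x : V) :
  rnorm (a%:C *: x) = `|a| * rnorm x.
Proof. by rewrite rnormZ cabs_real. Qed.

(** Linear over the reals only; [real_linear_scale] gives the effect of a complex
    factor. *)
Definition real_linear (R : realType) (V : lmodType R[i]) (psi : V -> R) :=
  (forall x y, psi (x + y) = psi x + psi y) /\
  (forall (a : R) x, psi (a%:C *: x) = a * psi x).

(** The Hahn-Banach theorem for one vector.  Functionals on subspaces are encoded
    by their graphs, ordered by inclusion.  The third clause of P makes such a
    graph single-valued, and the last one puts y0 in its domain unless it is
    empty, so that the union of an empty chain is admissible too.  A maximal
    graph is total by the usual one-dimensional extension. *)
Lemma norming_functional (R : realType) (V : normedModType R[i]) (y0 : V) :
  exists psi : V -> R, [/\ real_linear psi,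
    forall x, `|psi x| <= rnorm x & psi y0 = rnorm y0].
Proof.
pose P (G : set (V * R)) := [/\
  forall x r y s, G (x, r) -> G (y, s) -> G (x + y, r + s),
  forall (a : R) x r, G (x, r) -> G (a%:C *: x, a * r),
  forall x r, G (x, r) -> r <= rnorm x &
  forall x r, G (x, r) -> G (y0, rnorm y0)].
have [F FP Ftot|G [[GD GZ GN Gy0] Gmax]] := @Zorn_bigcup _ P.
  split.
  - move=> x r y s [A FA Ax] [B FB By].
    have [AB|BA] := Ftot A B FA FB.
      by exists B => //; have [h _ _ _] := FP B FB; apply: h => //; exact: AB.
    by exists A => //; have [h _ _ _] := FP A FA; apply: h => //; exact: BA.
  - move=> a x r [A FA Ax]; exists A => //.
    by have [_ h _ _] := FP A FA; exact: h.
  - by move=> x r [A FA Ax]; have [_ _ h _] := FP A FA; exact: h.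
  - by move=> x r [A FA Ax]; exists A => //; have [_ _ _ h] := FP A FA; exact: h Ax.
have Gy : G (y0, rnorm y0).
  apply: contrapT => nG.
  have G0 x r : ~ G (x, r) by move=> /Gy0.
  pose L : set (V * R) := [set z | exists a : R, z = (a%:C *: y0, a * rnorm y0)].
  apply: (Gmax L).
    split; first by move=> [x r] /G0.
    by move=> /(_ (y0, rnorm y0)) h; apply: nG; apply: h; exists 1; rewrite scale1r mul1r.
  split.
  - move=> x r y s [a [-> ->]] [b [-> ->]]; exists (a + b).
    by rewrite rmorphD/= scalerDl mulrDl.
  - by move=> b x r [a [-> ->]]; exists (b * a); rewrite rmorphM/= scalerA mulrA.
  - move=> x r [a [-> ->]]; rewrite rnormZr ler_wpM2r ?rnorm_ge0//.
    exact: ler_norm.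
  - by move=> x r _; exists 1; rewrite scale1r mul1r.
have G00 : G (0, 0) by have := GZ 0 _ _ Gy; rewrite scale0r mul0r.
have Gfun x r s : G (x, r) -> G (x, s) -> r <= s.
  move=> Gr Gs; have := GD _ _ _ _ Gr (GZ (-1) _ _ Gs).
  rewrite rmorphN1 scaleN1r subrr mulN1r => /GN.
  by rewrite rnorm0 subr_le0.
have Gtot v : exists r, G (v, r).
  apply: contrapT => nGv.
  (* The value c at v must be an upper bound of E below all the bounds of Eub. *)
  pose E : set R := [set c | exists x r, G (x, r) /\ c = r - rnorm (x - v)].
  have Eub y s : G (y, s) -> ubound E (rnorm (y + v) - s).
    move=> Gys c [x [r [Gxr ->]]].
    rewrite lerBrDr addrAC lerBlDr (le_trans (GN _ _ (GD _ _ _ _ Gxr Gys)))//.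
    rewrite (_ : x + y = (x - v) + (y + v)); last by rewrite addrACA addNr addr0.
    by rewrite addrC (le_trans (ler_rnormD _ _)) // addrC.
  have E0 : E !=set0 by exists (0 - rnorm (0 - v)), 0, 0.
  have Es : has_sup E by split=> //; exists (rnorm (y0 + v) - rnorm y0); exact: Eub.
  pose c := sup E.
  have cu y s : G (y, s) -> s + c <= rnorm (y + v).
    by move=> Gys; rewrite addrC -lerBrDr; apply: ge_sup => //; exact: Eub.
  have cl x r : G (x, r) -> r - c <= rnorm (x - v).
    move=> Gxr; rewrite lerBlDr addrC -lerBlDr.
    by apply: ub_le_sup; [case: Es|exists x, r].
  pose L : set (V * R) := [set z | exists x r (t : R),
     G (x, r) /\ z = (x + t%:C *: v, r + t * c)].
  apply: (Gmax L).
    split; first by move=> [x r] Gx; exists x, r, 0; rewrite scale0r mul0r !addr0.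
    move=> h; apply: nGv; exists c; apply: h; exists 0, 0, 1.
    by rewrite scale1r mul1r !add0r.
  split.
  - move=> _ _ _ _ [x [r [t [Gx [-> ->]]]]] [y [s [u [Gy' [-> ->]]]]].
    exists (x + y), (r + s), (t + u); split; first exact: GD.
    by rewrite rmorphD/= scalerDl mulrDl (addrACA x) (addrACA r).
  - move=> b _ _ [x [r [t [Gx [-> ->]]]]]; exists (b%:C *: x), (b * r), (b * t).
    by split; [exact: GZ|rewrite rmorphM/= scalerDr scalerA mulrDr mulrA].
  - move=> _ _ [x [r [t [Gx [-> ->]]]]].
    have [t0|t0|->] := ltrgtP t 0; last first.
    + by rewrite scale0r mul0r !addr0; exact: GN.
    + have := cu _ _ (GZ t^-1 _ _ Gx).
      rewrite -(ler_pM2l t0) mulrDr mulrA mulfV ?gt_eqF// mul1r => /le_trans; apply.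
      rewrite -[X in X * _](gtr0_norm t0) -rnormZr scalerDr scalerA -rmorphM/=.
      by rewrite mulfV ?gt_eqF// scale1r.
    + have t0' : 0 < - t by rewrite oppr_gt0.
      have := cl _ _ (GZ (- t)^-1 _ _ Gx).
      rewrite -(ler_pM2l t0') mulrBr mulrA mulfV ?gt_eqF// mul1r mulNr opprK.
      move=> /le_trans; apply.
      rewrite -[X in X * _](gtr0_norm t0') -rnormZr scalerBr scalerA -rmorphM/=.
      by rewrite mulfV ?gt_eqF// scale1r rmorphN scaleNr opprK.
  - by move=> _ _ _; exists y0, (rnorm y0), 0; rewrite scale0r mul0r !addr0.
pose psi v := projT1 (cid (Gtot v)).
have psiG v : G (v, psi v) by rewrite /psi; case: cid.
have psiE v r : G (v, r) -> psi v = r.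
  by move=> Gr; apply/le_anti; rewrite !(Gfun v).
have psiZ (a : R) x : psi (a%:C *: x) = a * psi x by apply: psiE; exact: GZ.
exists psi; split; last exact: psiE.
  by split=> [x y|//]; apply: psiE; exact: GD.
move=> x; rewrite ler_norml GN// andbT lerNl -rnormN.
apply: GN; rewrite -mulN1r -psiZ rmorphN1 scaleN1r; exact: psiG.
Qed.

(** * Functionals and the Bochner integral *)

(** Comparison holds without measurability, since the integral of a nonnegative
    function is a supremum over the simple functions below it.  It spares
    measurability proofs for norms of vector-valued functions. *)
Lemma ge0_le_integral_nonmeasurable d (T : measurableType d) (R : realType)
    (mu : {measure set T -> \bar R}) (D : set T) (f g : T -> \bar R) :
  (forall t, D t -> (0 <= f t)%E) -> (forall t, D t -> (f t <= g t)%E) ->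
  (\int[mu]_(t in D) f t <= \int[mu]_(t in D) g t)%E.
Proof.
move=> f0 fg; have g0 t : D t -> (0 <= g t)%E.
  by move=> Dt; rewrite (le_trans (f0 t Dt))// fg.
rewrite !ge0_integralE//; apply: ereal_sup_le => _ [h hf <-]; exists h => // t.
rewrite (le_trans (hf t))// !patchE; case: ifPn => // /[!inE] Dt.
exact: fg.
Qed.

Lemma real_linear0 (R : realType) (V : lmodType R[i]) (psi : V -> R) :
  real_linear psi -> psi 0 = 0.
Proof. by move=> [_ psiZ]; have := psiZ 0 0; rewrite scaler0 mul0r. Qed.

Lemma real_linearN (R : realType) (V : lmodType R[i]) (psi : V -> R) x :
  real_linear psi -> psi (- x) = - psi x.
Proof.
by move=> [_ psiZ]; have := psiZ (-1) x; rewrite rmorphN1 scaleN1r mulN1r.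
Qed.

Lemma real_linearB (R : realType) (V : lmodType R[i]) (psi : V -> R) x y :
  real_linear psi -> psi (x - y) = psi x - psi y.
Proof. by move=> psiL; rewrite psiL.1 real_linearN. Qed.

Lemma real_linear_sum (R : realType) (V : lmodType R[i]) (psi : V -> R)
    (I : Type) (r : seq I) (F : I -> V) : real_linear psi ->
  psi (\sum_(i <- r) F i) = \sum_(i <- r) psi (F i).
Proof.
by move=> psiL; apply: (big_morph psi psiL.1); exact: real_linear0.
Qed.

Lemma simple_functional d (T : measurableType d) (R : realType)
    (V : normedModType R[i]) (mu : {measure set T -> \bar R}) (D : set T)
    (psi : V -> R) (s : simple_comb T V) :
  measurable D -> real_linear psi -> simple_on mu D s ->
  mu.-integrable D (EFin \o (psi \o simple_eval s)) /\
  Rintegral mu D (psi \o simple_eval s) = psi (simple_integral mu s).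
Proof.
move=> mD psiL sD.
have E t : psi (simple_eval s t) =
    \sum_(i < sc_size s) psi (sc_val s i) * \1_(sc_set s i) t.
  rewrite /simple_eval real_linear_sum//; apply: eq_bigr => i _.
  rewrite (_ : (\1_(sc_set s i) t : R[i]) = (\1_(sc_set s i) t : R)%:C).
    by rewrite psiL.2 mulrC.
  by rewrite !indicE rmorph_nat.
have int1 i : mu.-integrable D (EFin \o (\1_(sc_set s i) : T -> R)).
  have [mS SD fS] := sD i.
  apply/integrableP; split; first exact/measurable_EFinP/measurable_indic.
  under eq_integral do rewrite /= ger0_norm//.
  by rewrite integral_indic// (setIidl SD).
have intZ i : mu.-integrable D
    (fun t => (psi (sc_val s i) * \1_(sc_set s i) t)%:E).
  rewrite (_ : (fun t => _) = (fun t =>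
    (psi (sc_val s i))%:E * (\1_(sc_set s i) t)%:E)%E)//.
  by apply: integrableZl => //; exact: int1.
have E' : EFin \o (psi \o simple_eval s) = (fun t => \sum_(i < sc_size s)
    (psi (sc_val s i) * \1_(sc_set s i) t)%:E)%E.
  by apply/funext => t /=; rewrite E sumEFin.
split; first by rewrite E'; exact: integrable_sum.
rewrite /Rintegral -[X in integral _ _ X]/(EFin \o (psi \o simple_eval s)) E'.
rewrite integral_sum// /simple_integral real_linear_sum//.
transitivity (fine (\sum_(i < sc_size s) (psi ((fine (mu (sc_set s i)))%:C *: sc_val s i))%:E)%E).
  congr fine; apply: eq_bigr => i _; have [mS SD fS] := sD i.
  rewrite psiL.2 [RHS]EFinM fineK ?ge0_fin_numE//.
  under eq_integral do rewrite EFinM.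
  rewrite integralZl//; last exact: int1.
  by rewrite integral_indic// (setIidl SD) muleC.
by rewrite sumEFin.
Qed.

(** Integrating against psi commutes with the Bochner integral because psi is
    contractive: the error made on the n-th simple approximation is bounded by
    the L^1 distance to it. *)
Lemma bochner_contraction d (T : measurableType d) (R : realType)
    (V : normedModType R[i]) (mu : {measure set T -> \bar R}) (D : set T)
    (f : T -> V) (v : V) (psi : V -> R) :
  measurable D -> real_linear psi -> (forall x, `|psi x| <= rnorm x) ->
  mu.-integrable D (EFin \o (psi \o f)) -> is_bochner_integral mu D f v ->
  Rintegral mu D (psi \o f) = psi v.
Proof.
move=> mD psiL psik ipsi [s [sD _ sf sv]].
apply/eqP; rewrite -subr_eq0 -normr_le0; apply/ler_addgt0Pr => e e0; rewrite add0r.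
pose dn n := (\int[mu]_(t in D) (rnorm (f t - simple_eval (s n) t))%:E)%E.
have e2 : 0 < e / 2 by rewrite divr_gt0.
have /fine_cvgP[dfin dcvg] : dn n @[n --> \oo] --> (0 : R)%:E by [].
have [n [nfin nd nv]] : exists n, [/\ dn n \is a fin_num,
    fine (dn n) < e / 2 & rnorm (v - simple_integral mu (s n)) < e / 2].
  have dlt : \forall n \near \oo, fine (dn n) < e / 2.
    exact: (cvgr_lt _ dcvg).
  have vlt : \forall n \near \oo,
      rnorm (v - simple_integral mu (s n)) < e / 2.
    have : \forall n \near \oo,
        `|v - simple_integral mu (s n)| < (e / 2)%:C.
      by move/cvgrPdist_lt : sv; apply; rewrite ltcR.
    by apply: filterS => n; rewrite rnorm_normE ltcR.
  have [N _ h] := filterI dfin (filterI dlt vlt).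
  by exists N; have [/= ? [? ?]] := h N (leqnn N).
have [iS Is] := simple_functional mD psiL (sD n).
have I1 : `|Rintegral mu D (psi \o f) - psi (simple_integral mu (s n))| <=
    fine (dn n).
  rewrite -Is -RintegralB//.
  have ifs : mu.-integrable D (EFin \o (fun t => psi (f t) - psi (simple_eval (s n) t))).
    rewrite (_ : _ \o _ = (EFin \o (psi \o f)) \- (EFin \o (psi \o simple_eval (s n))))%E//.
    exact: integrableB.
  apply: (le_trans (le_normr_Rintegral mD ifs)).
  have inorm := integrable_norm ifs.
  rewrite -lee_fin !fineK//; last exact: integrable_fin_num.
  apply: ge0_le_integral_nonmeasurable => //.
  by move=> t _; rewrite lee_fin -real_linearB.
have I2 : `|psi (simple_integral mu (s n)) - psi v| < e / 2.
  by rewrite distrC -real_linearB// (le_lt_trans (psik _)).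
rewrite (le_trans (ler_distD (psi (simple_integral mu (s n))) _ _))//.
by lra.
Qed.

Lemma bochner_functional d (T : measurableType d) (R : realType)
    (V : normedModType R[i]) (mu : {measure set T -> \bar R}) (D : set T)
    (f : T -> V) (v : V) (psi : V -> R) (k : R) :
  measurable D -> real_linear psi -> 0 < k ->
  (forall x, `|psi x| <= k * rnorm x) ->
  mu.-integrable D (EFin \o (psi \o f)) -> is_bochner_integral mu D f v ->
  Rintegral mu D (psi \o f) = psi v.
Proof.
move=> mD psiL k0 psik ipsi fv.
pose phi x := k^-1 * psi x.
have phiL : real_linear phi.
  split=> [x y|a x]; first by rewrite /phi psiL.1 mulrDr.
  by rewrite /phi psiL.2 mulrCA.
have : Rintegral mu D (phi \o f) = phi v.
  apply: bochner_contraction fv => //.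
    by move=> x; rewrite normrM gtr0_norm ?invr_gt0// mulrC ler_pdivrMr// mulrC.
  rewrite (_ : _ \o _ = (fun t => k^-1%:E * (EFin \o (psi \o f)) t)%E)//.
  by apply: integrableZl.
rewrite /comp /phi RintegralZl//; apply: mulfI.
by rewrite invr_neq0// gt_eqF.
Qed.

(** * Complex exponentials and functionals along orbits *)

Lemma cexpD (R : realType) (z w : R[i]) : cexp (z + w) = cexp z * cexp w.
Proof.
case: z w => [a b] [c d]; rewrite /cexp /= expRD cosD sinD; simpc.
by congr (_ +i* _); ring.
Qed.

Lemma cabs_cexp (R : realType) (z : R[i]) : cabs (cexp z) = expR (complex.Re z).
Proof.
rewrite /cexp cabsM cabs_real ger0_norm ?expR_ge0// cabsE /=.
by rewrite cos2Dsin2 sqrtr1 mulr1.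
Qed.

Lemma cexp_laplace (R : realType) (lam : R[i]) (t : R) :
  cexp (- (lam * t%:C)) =
  (expR (- complex.Re lam * t) * cos (complex.Im lam * t)) +i*
  (- (expR (- complex.Re lam * t) * sin (complex.Im lam * t))).
Proof.
case: lam => c b; rewrite /cexp /=; simpc.
by rewrite cosN sinN mulrN.
Qed.

Lemma cabs_cexp_laplace (R : realType) (lam : R[i]) (t : R) :
  cabs (cexp (- (lam * t%:C))) = expR (- complex.Re lam * t).
Proof. by rewrite cabs_cexp; case: lam => c b /=; simpc. Qed.

(** This is how complex scalars act through a real-linear functional: psi and
    x |-> psi (i x) play the roles of real and imaginary part. *)
Lemma real_linear_scale (R : realType) (V : lmodType R[i]) (psi : V -> R)
    (z : R[i]) (x : V) : real_linear psi ->
  psi (z *: x) = complex.Re z * psi x + complex.Im z * psi ('i *: x).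
Proof.
move=> [psiD psiZ]; rewrite {1}(complexE z) scalerDl psiD psiZ mulrC.
by rewrite [in X in _ + X](mulrC 'i) -scalerA psiZ; congr (_ + _); rewrite mulrC.
Qed.

Lemma real_linear_comp_scale (R : realType) (V : lmodType R[i]) (psi : V -> R)
    (z : R[i]) : real_linear psi -> real_linear (fun x => psi (z *: x)).
Proof.
move=> [psiD psiZ]; split=> [x y|a x]; first by rewrite scalerDr psiD.
by rewrite scalerA mulrC -scalerA psiZ.
Qed.

Lemma functional_continuous (R : realType) (V : normedModType R[i])
    (psi : V -> R) (k : R) : real_linear psi -> 0 < k ->
  (forall x, `|psi x| <= k * rnorm x) -> continuous psi.
Proof.
move=> psiL k0 psik x; apply/cvgrPdist_lt => e e0.
have ek : 0 < (e / k)%:C by rewrite ltcR divr_gt0.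
near=> y.
have : `|x - y| < (e / k)%:C.
  by near: y; move: (@cvg_id _ (nbhs x)) => /cvgrPdist_lt; apply.
rewrite rnorm_normE ltcR ltr_pdivlMr// mulrC -real_linearB// => h.
by rewrite (le_lt_trans (psik _)).
Unshelve. all: by end_near. Qed.

Lemma half_continuous_measurable (R : realType) (f : R -> R) :
  {within `[0, +oo[, continuous f} -> measurable_fun setT (half f).
Proof.
move=> cf; apply/half_measurable.
by apply: subspace_continuous_measurable_fun.
Qed.

Lemma half_mul (R : realType) (f g : R -> R) t :
  half (fun s => f s * g s) t = half f t * half g t.
Proof. by rewrite /half; case: ifP; rewrite ?mul0r. Qed.

Lemma half_add (R : realType) (f g : R -> R) t :
  half (fun s => f s + g s) t = half f t + half g t.
Proof. by rewrite /half; case: ifP; rewrite ?addr0. Qed.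

Lemma continuous_exp_trig (R : realType) (lam : R[i]) :
  continuous (fun t : R => complex.Re (cexp (- (lam * t%:C)))) /\
  continuous (fun t : R => complex.Im (cexp (- (lam * t%:C)))).
Proof.
set c := - complex.Re lam; set b := complex.Im lam.
have cE : continuous (fun t : R => expR (c * t)).
  exact: (derivable_continuous (is_derive_expM c)).
have cl : continuous (fun t : R => b * t).
  exact: (derivable_continuous (is_derive_linear b)).
split.
  rewrite (_ : (fun t : R => _) = fun t : R => expR (c * t) * cos (b * t)); last first.
    by apply/funext => t; rewrite cexp_laplace.
  move=> t; apply: cvgM; first exact: cE.
  by apply: (@continuous_comp _ _ _ (fun t : R => b * t) cos); [exact: cl|exact: continuous_cos].
rewrite (_ : (fun t : R => _) = fun t : R => - (expR (c * t) * sin (b * t))); last first.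
  by apply/funext => t; rewrite cexp_laplace.
move=> t; apply: cvgN; apply: cvgM; first exact: cE.
by apply: (@continuous_comp _ _ _ (fun t : R => b * t) sin); [exact: cl|exact: continuous_sin].
Qed.

(** Boundedness of the orbit u makes the Laplace integrand integrable on every
    line Re lambda > 0; the uniform bound is what the convolution theorem asks
    for. *)
Lemma orbit_L1 (R : realType) (X : normedModType R[i]) (u : R -> X)
    (psi : X -> R) (k B : R) (lam : R[i]) :
  real_linear psi -> 0 < k -> (forall x, `|psi x| <= k * rnorm x) ->
  {within `[0, +oo[, continuous u} -> (forall t, 0 <= t -> rnorm (u t) <= B) ->
  0 < complex.Re lam ->
  L1 (half (fun s => psi (cexp (- (lam * s%:C)) *: u s))) /\
  exists M, forall s, `|half (fun s => psi (cexp (- (lam * s%:C)) *: u s)) s| <= M.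
Proof.
move=> psiL k0 psik cu uB l0.
have B0 : 0 <= B by rewrite (le_trans (rnorm_ge0 (u 0))) ?uB.
have cpsi phi : real_linear phi -> (forall x, `|phi x| <= k * rnorm x) ->
    measurable_fun setT (half (fun s => phi (u s))).
  move=> phiL phik; apply: half_continuous_measurable => x.
  apply: (@continuous_comp (subspace (`[0, +oo[%classic : set R)) X R u phi).
    exact: cu.
  exact: (functional_continuous phiL k0 phik).
have bnd s : `|half (fun s => psi (cexp (- (lam * s%:C)) *: u s)) s| <=
    k * B * half (fun s => expR (- complex.Re lam * s)) s.
  rewrite /half; case: ifPn => s0; last by rewrite normr0 mulr0.
  rewrite (le_trans (psik _))// rnormZ cabs_cexp_laplace -mulrA ler_pM2l//.
  by rewrite mulrC ler_wpM2r ?expR_ge0// uB.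
split; last first.
  exists (k * B) => s; rewrite (le_trans (bnd s))// ler_piMr//.
    by rewrite mulr_ge0// ltW.
  rewrite /half; case: ifPn => // s0.
  by rewrite -expR0 ler_expR mulNr oppr_le0 mulr_ge0// ltW.
apply: L1_dom bnd; last by apply: L1Z; have [] := exp_half l0.
have [cre cim] := continuous_exp_trig lam.
rewrite (_ : half _ = fun s =>
   half (fun s => complex.Re (cexp (- (lam * s%:C)))) s * half (fun s => psi (u s)) s
 + half (fun s => complex.Im (cexp (- (lam * s%:C)))) s * half (fun s => psi ('i *: u s)) s).
  apply: measurable_funD; apply: measurable_funM.
  - by apply: half_continuous_measurable; exact: continuous_subspaceT.
  - exact: cpsi.
  - by apply: half_continuous_measurable; exact: continuous_subspaceT.
  - apply: (cpsi (fun x => psi ('i *: x))); first exact: real_linear_comp_scale.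
    move=> x; rewrite (le_trans (psik _))// rnormZ.
    by rewrite cabsE /= expr0n expr1n add0r sqrtr1 mul1r.
apply/funext => s; rewrite -!half_mul -half_add /half.
by case: ifP => // _; rewrite real_linear_scale.
Qed.

(** * The Laplace transform of a solution family *)

Lemma L1_itv (R : realType) (i : interval R) (f : R -> R) :
  (@lebesgue_measure R).-integrable [set` i] (EFin \o f) <->
  L1 (f \_ [set` i]).
Proof. by rewrite /L1 -restrict_EFin; apply: integrable_mkcond. Qed.

Lemma kernel_measurable (R : realType) (a : R -> R[i]) : L1loc a ->
  measurable_fun setT (half (fun t => complex.Re (a t))) /\
  measurable_fun setT (half (fun t => complex.Im (a t))).
Proof.
move=> al.
have E : (`[0, +oo[%classic : set R) = \bigcup_n `[0, n%:R]%classic.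
  apply/seteqP; split => t /=.
    rewrite in_itv/= andbT => t0; exists (Num.truncn t).+1 => //=.
    by rewrite in_itv/= t0/= ltW// truncnS_gt.
  by move=> [n _ /=]; rewrite !in_itv/= andbT => /andP[].
by split; apply/half_measurable; rewrite E;
  (apply/measurable_fun_bigcup => [n|n]; first exact: measurable_itv);
  have [/integrableP[/measurable_EFinP ? _] /integrableP[/measurable_EFinP ? _]] := al n%:R.
Qed.

Lemma kernel_weight_L1 (R : realType) (a : R -> R[i]) (c : R) :
  L1loc a -> subexponential a -> 0 < c ->
  L1 (half (fun t => expR (- c * t) * cabs (a t))).
Proof.
move=> al asub c0; have [mre mim] := kernel_measurable al.
apply/half_L1/integrableP; split.
  apply/measurable_EFinP/half_measurable.
  rewrite (_ : half _ = fun t => half (fun t => expR (- c * t)) t *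
    Num.sqrt (half (fun t => complex.Re (a t)) t ^+ 2 +
              half (fun t => complex.Im (a t)) t ^+ 2)); last first.
    by apply/funext => t; rewrite /half; case: ifP; rewrite ?mul0r// cabsE.
  apply: measurable_funM.
    by have [/L1_measurable] := exp_half c0.
  apply: (@measurableT_comp _ _ _ _ _ _ (@Num.sqrt R)).
    exact: (continuous_measurable_fun (@sqrt_continuous R)).
  by apply: measurable_funD; apply: measurable_funX.
have := asub c c0; apply: le_lt_trans.
rewrite le_eqVlt; apply/orP; left; apply/eqP; apply: eq_integral => t _ /=.
by rewrite ger0_norm ?mulr_ge0 ?expR_ge0 ?cabs_ge0// mulNr.
Qed.

(** All complex integrals against the kernel a that occur below have this form,
    with an exponentially decaying multiplier m: the factor e^(-lambda t), its
    derivative in lambda, and Taylor remainders of it. *)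
Lemma kernel_multiplier_L1 (R : realType) (a m : R -> R[i]) (c K : R) :
  L1loc a -> subexponential a -> 0 < c ->
  continuous (fun t => complex.Re (m t)) ->
  continuous (fun t => complex.Im (m t)) ->
  (forall t, 0 <= t -> cabs (m t) <= K * expR (- c * t)) ->
  let N := intR (half (fun t => expR (- c * t) * cabs (a t))) in
  [/\ L1 (half (fun t => complex.Re (m t * a t))),
      L1 (half (fun t => complex.Im (m t * a t))),
      `|intR (half (fun t => complex.Re (m t * a t)))| <= K * N &
      `|intR (half (fun t => complex.Im (m t * a t)))| <= K * N].
Proof.
move=> al asub c0 cre cim mK N; have [mre mim] := kernel_measurable al.
have iw := kernel_weight_L1 al asub c0.
have cm (f : R -> R) : continuous f -> measurable_fun setT (half f).
  by move=> cf; apply: half_continuous_measurable; exact: continuous_subspaceT.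
have bnd t : 0 <= t -> cabs (m t * a t) <= K * (expR (- c * t) * cabs (a t)).
  by move=> t0; rewrite cabsM mulrA ler_wpM2r ?cabs_ge0// mK.
have dre t : `|half (fun t => complex.Re (m t * a t)) t| <=
    K * half (fun t => expR (- c * t) * cabs (a t)) t.
  rewrite /half; case: ifP => t0; last by rewrite normr0 mulr0.
  by rewrite (le_trans (Re_le_cabs _))// bnd.
have dim t : `|half (fun t => complex.Im (m t * a t)) t| <=
    K * half (fun t => expR (- c * t) * cabs (a t)) t.
  rewrite /half; case: ifP => t0; last by rewrite normr0 mulr0.
  by rewrite (le_trans (Im_le_cabs _))// bnd.
have ire : L1 (half (fun t => complex.Re (m t * a t))).
  apply: L1_dom dre; last exact: L1Z.
  rewrite (_ : half _ = fun t =>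
     half (fun t => complex.Re (m t)) t * half (fun t => complex.Re (a t)) t
   - half (fun t => complex.Im (m t)) t * half (fun t => complex.Im (a t)) t).
    by apply: measurable_funB; apply: measurable_funM => //; exact: cm.
  apply/funext => t; rewrite /half; case: ifP => _; last by rewrite !mul0r subr0.
  by case: (m t) (a t) => ? ? [].
have iim : L1 (half (fun t => complex.Im (m t * a t))).
  apply: L1_dom dim; last exact: L1Z.
  rewrite (_ : half _ = fun t =>
     half (fun t => complex.Re (m t)) t * half (fun t => complex.Im (a t)) t
   + half (fun t => complex.Im (m t)) t * half (fun t => complex.Re (a t)) t).
    by apply: measurable_funD; apply: measurable_funM => //; exact: cm.
  apply/funext => t; rewrite /half; case: ifP => _; last by rewrite !mul0r addr0.
  by case: (m t) (a t) => ? ? [].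
split=> //; rewrite /N -intRZ//; apply: intR_le_norm => //; exact: L1Z.
Qed.

Lemma laplaceE (R : realType) (a : R -> R[i]) (lam : R[i]) :
  laplace a lam =
  intR (half (fun t => complex.Re (cexp (- (lam * t%:C)) * a t))) +i*
  intR (half (fun t => complex.Im (cexp (- (lam * t%:C)) * a t))).
Proof. by rewrite /laplace /Cintegral !half_int. Qed.

Lemma laplace_kernel_L1 (R : realType) (a : R -> R[i]) (lam : R[i]) :
  L1loc a -> subexponential a -> 0 < complex.Re lam ->
  L1 (half (fun t => complex.Re (cexp (- (lam * t%:C)) * a t))) /\
  L1 (half (fun t => complex.Im (cexp (- (lam * t%:C)) * a t))).
Proof.
move=> al asub l0; have [cre cim] := continuous_exp_trig lam.
have [|i1 i2 _ _] := @kernel_multiplier_L1 R a _ _ 1 al asub l0 cre cim.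
  by move=> t _; rewrite cabs_cexp_laplace mul1r.
by split.
Qed.

Lemma laplace_functional_linear (R : realType) (X : normedModType R[i])
    (S : R -> {linear X -> X}) (psi : X -> R) (lam : R[i]) :
  real_linear psi ->
  (forall y, L1 (half (fun s => psi (cexp (- (lam * s%:C)) *: S s y)))) ->
  real_linear (fun y =>
    intR (half (fun s => psi (cexp (- (lam * s%:C)) *: S s y)))).
Proof.
move=> psiL iL; split=> [x y|b x].
  rewrite -intRD//; congr intR; apply/funext => s; rewrite -half_add /half.
  by case: ifP => // _; rewrite linearD scalerDr psiL.1.
rewrite -intRZ//; congr intR; apply/funext => s; rewrite /half.
case: ifP => _; last by rewrite mulr0.
by rewrite [S s _]linearZ/= scalerA mulrC -scalerA psiL.2.
Qed.

(** For x in D(A) the Volterra equation gives, after the transform,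
      L(x) = psi(x / lambda) + L(a^(lambda) A x),
    with L the transform of psi(S(.) y) as a function of y and a^ the transform
    of the kernel; the second term is the convolution theorem.  Since
    I - a^(lambda) A maps D(A) onto X this identifies L with
    psi o H(lambda). *)
Lemma laplace_solution (R : realType) (X : normedModType R[i])
    (A : unbounded_operator X) (a : R -> R[i]) (S : R -> {linear X -> X})
    (psi : X -> R) (k B : R) (lam : R[i]) (x : X) :
  L1loc a -> subexponential a -> solution_family A a S ->
  (forall t y, 0 <= t -> rnorm (S t y) <= B * rnorm y) ->
  real_linear psi -> 0 < k -> (forall y, `|psi y| <= k * rnorm y) ->
  0 < complex.Re lam -> dom A x ->
  intR (half (fun s =>
    psi (cexp (- (lam * s%:C)) *: S s (x - laplace a lam *: A x)))) =
  psi (lam^-1 *: x).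
Proof.
move=> al asub [_ S0 Sc SA Seq] SB psiL k0 psik l0 Ax.
pose L phi y := intR (half (fun s => phi (cexp (- (lam * s%:C)) *: S s y))).
have iL y := @orbit_L1 R X (fun s => S s y) psi k (B * rnorm y) lam psiL k0 psik
  (Sc y) (fun t t0 => SB t y t0) l0.
have LL : real_linear (L psi).
  by apply: laplace_functional_linear => // y; have [] := iL y.
pose z := A x.
set b1 := half (fun t => complex.Re (cexp (- (lam * t%:C)) * a t)).
set b2 := half (fun t => complex.Im (cexp (- (lam * t%:C)) * a t)).
have [ib1 ib2] : L1 b1 /\ L1 b2 := laplace_kernel_L1 al asub l0.
(* The complex convolution splits: the real part of the kernel is paired
   with z, the imaginary part with i z. *)
pose p := half (fun s => psi (cexp (- (lam * s%:C)) *: S s z)).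
pose q := half (fun s => psi (cexp (- (lam * s%:C)) *: S s ('i *: z))).
have [ip [Mp pM]] : L1 p /\ exists M, forall s, `|p s| <= M := iL z.
have [iq [Mq qM]] : L1 q /\ exists M, forall s, `|q s| <= M := iL ('i *: z).
have [c1 ic1 Ec1] := convolution_intR ib1 ip pM.
have [c2 ic2 Ec2] := convolution_intR ib2 iq qM.
have convE t : 0 <= t -> psi (cexp (- (lam * t%:C)) *: (S t x)) =
   psi (cexp (- (lam * t%:C)) *: x) +
   (intR (fun s => b1 (t - s) * p s) + intR (fun s => b2 (t - s) * q s)).
  move=> t0; have [v hv ->] := Seq t x t0 Ax.
  rewrite scalerDr psiL.1; congr (_ + _).
  pose phi y := psi (cexp (- (lam * t%:C)) *: y).
  have phiL : real_linear phi by exact: real_linear_comp_scale.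
  pose f s := a (t - s) *: A (S s x).
  have fE : (phi \o f) \_ `[0, t] = fun s => b1 (t - s) * p s + b2 (t - s) * q s.
    apply/funext => s; rewrite patchE /b1 /b2 /p /q /half.
    have [/[!inE]/= /[!in_itv]/= /andP[s0 st]|] := boolP (s \in _).
      rewrite s0 subr_ge0 st /phi /f (SA _ _ s0 Ax).2 -/z.
      rewrite scalerA -[X in cexp X](_ : - (lam * (t - s)%:C) - lam * s%:C = _).
        rewrite cexpD -mulrA [cexp (- (lam * s%:C)) * _]mulrC mulrA -scalerA.
        rewrite real_linear_scale// [S s ('i *: z)]linearZ/=.
        by congr (_ + _ * psi _); rewrite !scalerA mulrC.
      by rewrite rmorphB/= mulrBr opprB addrAC subrr add0r.
    rewrite notin_setE/= in_itv/= => /negP; rewrite negb_and -!ltNge.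
    case: ifPn => st; case: ifPn => s0; rewrite ?mul0r ?mulr0 ?addr0//.
    by rewrite ltNge s0/= ltNge -subr_ge0 st.
  have iphi : (@lebesgue_measure R).-integrable `[0, t] (EFin \o (phi \o f)).
    by apply/L1_itv; rewrite fE; exact: L1D.
  have k1 : 0 < k * expR (- complex.Re lam * t) by rewrite mulr_gt0 ?expR_gt0.
  have phik y : `|phi y| <= k * expR (- complex.Re lam * t) * rnorm y.
    by rewrite (le_trans (psik _))// rnormZ cabs_cexp_laplace mulrA.
  rewrite -[LHS](bochner_functional _ phiL k1 phik iphi hv)//.
  by rewrite Rintegral_mkcond fE -[LHS]/(intR _) intRD.
pose conv t := intR (fun s => b1 (t - s) * p s) + intR (fun s => b2 (t - s) * q s).
have conv0 t : t < 0 -> conv t = 0.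
  move=> t0; rewrite /conv.
  have z0 (b w : R -> R) : intR (fun s => half b (t - s) * half w s) = 0.
    rewrite (_ : (fun s => _) = cst 0) ?[LHS]Rintegral_cst ?mul0r//.
    apply/funext => s; rewrite /half; case: ifPn => st; case: ifPn => s0;
      rewrite ?mul0r ?mulr0//.
    by move: st; rewrite subr_ge0 leNgt (lt_le_trans t0).
  by rewrite !z0 addr0.
have [ic Ic] := cos_exp_half (complex.Im lam) l0.
have [isn Is] := sin_exp_half (complex.Im lam) l0.
pose h t := half (fun t => expR (- complex.Re lam * t) * cos (complex.Im lam * t)) t.
pose h' t := half (fun t => expR (- complex.Re lam * t) * sin (complex.Im lam * t)) t.
have Lx : L psi x = psi (lam^-1 *: x) + (intR b1 * intR p + intR b2 * intR q).
  rewrite -Ec1 -Ec2 -intRD// /L.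
  rewrite (_ : half _ = fun t => (psi x * h t + - psi ('i *: x) * h' t) + conv t).
    have i1 : L1 (fun t => psi x * h t) by exact: L1Z.
    have i2 : L1 (fun t => - psi ('i *: x) * h' t) by exact: L1Z.
    have i3 : L1 conv by exact: L1D.
    rewrite (intRD (L1D i1 i2) i3) (intRD i1 i2).
    rewrite (intRZ _ ic) (intRZ _ isn) Ic Is (real_linear_scale lam^-1 x psiL); congr (_ + _).
    by case: (lam) => c b /=; ring.
  apply/funext => t; rewrite /h /h' /half; case: ifPn => t0; last first.
    by rewrite conv0 ?ltNge// !mulr0 !addr0.
  rewrite convE// (real_linear_scale (cexp _) x psiL) cexp_laplace/=.
  by congr (_ + _); ring.
have Lz : L psi (laplace a lam *: z) = intR b1 * intR p + intR b2 * intR q.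
  by rewrite [LHS](real_linear_scale _ _ LL) laplaceE.
by rewrite -[LHS]/(L psi _) (real_linearB _ _ LL) Lx Lz addrK.
Qed.

(** * A Taylor bound for the complex exponential *)

Lemma mvt_norm_le (R : realType) (f df : R -> R) (a b M : R) : a <= b ->
  (forall x : R, a <= x <= b -> is_derive x 1 f (df x)) ->
  (forall x, a <= x <= b -> `|df x| <= M) ->
  `|f b - f a| <= M * (b - a).
Proof.
move=> ab fd dM.
have [||x xab ->] := @MVT_segment R f df a b ab.
- by move=> x; rewrite in_itv/= => /andP[ax xb]; apply: fd; rewrite !ltW.
- apply: derivable_within_continuous => x; rewrite in_itv/= => xab.
  by have [] := fd x xab.
rewrite normrM (@ger0_norm _ (b - a)) ?subr_ge0// ler_wpM2r ?subr_ge0//.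
by apply: dM; move: xab; rewrite in_itv.
Qed.

Lemma mvt0_norm_le (R : realType) (f df : R -> R) (x M : R) :
  (forall x : R, is_derive x 1 f (df x)) ->
  (forall z, `|z| <= `|x| -> `|df z| <= M) ->
  `|f x - f 0| <= M * `|x|.
Proof.
move=> fd dM; have [x0|x0] := leP 0 x.
  rewrite (ger0_norm x0) -{2}(subr0 x); apply: (mvt_norm_le x0) => // z /andP[z0 zx].
  by apply: dM; rewrite !ger0_norm.
rewrite distrC (ltr0_norm x0) -[- x]sub0r.
apply: (mvt_norm_le (ltW x0)) => // z /andP[zx z0].
by apply: dM; rewrite !ler0_norm ?lerN2// ltW.
Qed.

Lemma sin_norm_le (R : realType) (y : R) : `|sin y| <= `|y|.
Proof.
rewrite -[leRHS]mul1r -[sin y]subr0 -sin0.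
apply: mvt0_norm_le => z _.
by rewrite ler_norml cos_geN1 cos_le1.
Qed.

Lemma cosB1_norm_le (R : realType) (y M : R) : `|y| <= M ->
  `|cos y - 1| <= M * `|y|.
Proof.
move=> yM; rewrite -cos0; apply: (mvt0_norm_le (fun x => is_derive_cos x)) => z zy.
by rewrite normrN (le_trans (sin_norm_le z))// (le_trans zy).
Qed.

Lemma sinB_norm_le (R : realType) (y : R) : `|sin y - y| <= `|y| * `|y|.
Proof.
have d (x : R) : is_derive x 1 (fun y : R => sin y - y) (cos x - 1).
  exact: is_deriveB.
have := @mvt0_norm_le R _ _ y `|y| d.
rewrite sin0 !subr0; apply => z zy.
rewrite (le_trans _ zy)//.
have := @mvt0_norm_le R cos _ z 1 (fun x => is_derive_cos x).
rewrite cos0 mul1r; apply => x _; rewrite normrN.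
by rewrite ler_norml sin_geN1 sin_le1.
Qed.

Lemma expRB1_norm_le (R : realType) (x M : R) : `|x| <= M ->
  `|expR x - 1| <= expR M * `|x|.
Proof.
move=> xM; rewrite -expR0; apply: (mvt0_norm_le (fun x => is_derive_expR x)) => z zx.
by rewrite ger0_norm ?expR_ge0// ler_expR (le_trans (ler_norm z))// (le_trans zx).
Qed.

Lemma expRB1B_norm_le (R : realType) (x : R) :
  `|expR x - 1 - x| <= expR `|x| * `|x| * `|x|.
Proof.
have d (y : R) : is_derive y 1 (fun x : R => expR x - 1 - x) (expR y - 0 - 1).
  by apply: is_deriveB.
have := @mvt0_norm_le R _ _ x (expR `|x| * `|x|) d.
rewrite expR0 subrr !subr0; apply => z zx; rewrite subr0.
by rewrite (le_trans (expRB1_norm_le zx))// ler_wpM2l// expR_ge0.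
Qed.

(** The real and imaginary parts are split into one-variable remainders, each
    estimated by the mean value theorem. *)
Lemma cexp_taylor (R : realType) (w : R[i]) :
  cabs (cexp w - 1 - w) <= 4 * (cabs w ^+ 2 * expR (cabs w)).
Proof.
have xr := Re_le_cabs w; have yr := Im_le_cabs w.
set r := cabs w in xr yr *; have r0 : 0 <= r by exact: cabs_ge0.
have E1 : 1 <= expR r by rewrite -expR0 ler_expR.
have e1 := expRB1_norm_le xr; have e2 := expRB1B_norm_le (complex.Re w).
have c1 := cosB1_norm_le yr.
have s1 := sin_norm_le (complex.Im w); have s2 := sinB_norm_le (complex.Im w).
apply: (le_trans (cabs_le_ReIm _)).
case: w @r xr yr r0 E1 e1 e2 c1 s1 s2 => x y /=.
set r := cabs _ => xr yr r0 E1 e1 e2 c1 s1 s2; simpc.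
have ex : expR x <= expR r by rewrite ler_expR (le_trans (ler_norm x)).
have ex' : expR `|x| <= expR r by rewrite ler_expR.
have x0 := normr_ge0 x; have y0 := normr_ge0 y.
have xx : `|x| * `|x| <= r ^+ 2 by rewrite expr2 ler_pM.
have xy : `|x| * `|y| <= r ^+ 2 by rewrite expr2 ler_pM.
have yy : `|y| * `|y| <= r ^+ 2 by rewrite expr2 ler_pM.
have r2 : r ^+ 2 <= r ^+ 2 * expR r by rewrite ler_peMr// sqr_ge0.
have h1 : `|expR x * cos y - 1 - x| <= 2 * (r ^+ 2 * expR r).
  rewrite (_ : _ - x = (expR x - 1 - x) + expR x * (cos y - 1)); last by ring.
  rewrite (le_trans (ler_normD _ _))// (mulrDl 1 1) mul1r lerD//.
    rewrite (le_trans e2)// -mulrA mulrC ler_pM ?expR_ge0// mulr_ge0//.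
  rewrite normrM (ger0_norm (expR_ge0 _)) mulrC ler_pM ?expR_ge0//.
  by rewrite (le_trans c1)// expr2 ler_wpM2l.
have h2 : `|expR x * sin y - y| <= 2 * (r ^+ 2 * expR r).
  rewrite (_ : _ - y = (expR x - 1) * sin y + (sin y - y)); last by ring.
  rewrite (le_trans (ler_normD _ _))// (mulrDl 1 1) mul1r lerD//; last first.
    by rewrite (le_trans s2)// (le_trans yy).
  rewrite normrM (@le_trans _ _ (expR r * `|x| * `|y|))//.
    by rewrite ler_pM.
  by rewrite -mulrA mulrC ler_pM ?expR_ge0// mulr_ge0.
by lra.
Qed.

(** * The derivative of the transform of the kernel *)

Lemma id_le_expR (R : realType) (c t : R) : 0 < c -> 0 <= t ->
  t <= c^-1 * expR (c * t).
Proof.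
move=> c0 t0; rewrite -ler_pdivrMl ?invr_gt0// invrK.
by rewrite (le_trans _ (expR_ge1Dx _))// lerDr.
Qed.

Lemma sqr_le_expR (R : realType) (c t : R) : 0 < c -> 0 <= t ->
  t ^+ 2 <= 4 / c ^+ 2 * expR (c * t).
Proof.
move=> c0 t0; have c2 : 0 < c / 2 by rewrite divr_gt0.
have -> : 4 / c ^+ 2 * expR (c * t) = ((c / 2)^-1 * expR (c / 2 * t)) ^+ 2.
  rewrite exprMn -[X in _ = _ * X]expRM_natl; congr (_ * expR _).
    by field; rewrite gt_eqF.
  by rewrite mulrA -[2%:R * _]mulrC mulfVK.
rewrite ler_pXn2r ?nnegrE//; first exact: id_le_expR.
by rewrite mulr_ge0 ?expR_ge0// invr_ge0 ltW.
Qed.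

Definition kernel_int (R : realType) (a m : R -> R[i]) : R[i] :=
  intR (half (fun t => complex.Re (m t * a t))) +i*
  intR (half (fun t => complex.Im (m t * a t))).

(** The rate c is kept fixed while multipliers are combined; only the constant K
    changes. *)
Definition exp_multiplier (R : realType) (c K : R) (m : R -> R[i]) :=
  [/\ continuous (fun t : R => complex.Re (m t)),
      continuous (fun t : R => complex.Im (m t)) &
      forall t, 0 <= t -> cabs (m t) <= K * expR (- c * t)].

Lemma kernel_int_bound (R : realType) (a m : R -> R[i]) (c K : R) :
  L1loc a -> subexponential a -> 0 < c -> exp_multiplier c K m ->
  cabs (kernel_int a m) <=
    2 * (K * intR (half (fun t => expR (- c * t) * cabs (a t)))).
Proof.
move=> al asub c0 [mre mim mK].
have [_ _ h1 h2] := kernel_multiplier_L1 al asub c0 mre mim mK.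
by rewrite (le_trans (cabs_le_ReIm _))//= (mulrDl 1 1) mul1r lerD.
Qed.

Lemma intR_linear3 (R : realType) (f g k : R -> R) (p q : R) :
  L1 f -> L1 g -> L1 k ->
  intR (fun x => f x + (p * g x + q * k x)) = intR f + (p * intR g + q * intR k).
Proof.
move=> fi gi ki.
have gi' : L1 (fun x => p * g x) by exact: L1Z.
have ki' : L1 (fun x => q * k x) by exact: L1Z.
by rewrite (intRD fi (L1D gi' ki')) (intRD gi' ki') !intRZ.
Qed.

Lemma kernel_intZD (R : realType) (a m n : R -> R[i]) (c K K' : R) (z : R[i]) :
  L1loc a -> subexponential a -> 0 < c ->
  exp_multiplier c K m -> exp_multiplier c K' n ->
  kernel_int a (fun t => m t + z * n t) = kernel_int a m + z * kernel_int a n.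
Proof.
move=> al asub c0 [mre mim mK] [nre nim nK].
have [i1 i2 _ _] := kernel_multiplier_L1 al asub c0 mre mim mK.
have [j1 j2 _ _] := kernel_multiplier_L1 al asub c0 nre nim nK.
rewrite /kernel_int; case: z => x y; simpc; congr (_ +i* _).
  rewrite -[- (y * _)]mulNr -intR_linear3//; congr intR; apply/funext => t.
  rewrite /half; case: ifP => _; last by rewrite !mulr0 !addr0.
  by case: (m t) (n t) (a t) => m1 m2 [n1 n2] [a1 a2]; simpc => /=; ring.
rewrite -intR_linear3//; congr intR; apply/funext => t.
rewrite /half; case: ifP => _; last by rewrite !mulr0 !addr0.
by case: (m t) (n t) (a t) => m1 m2 [n1 n2] [a1 a2]; simpc => /=; ring.
Qed.

Lemma exp_multiplierZD (R : realType) (m n : R -> R[i]) (c K K' : R) (z : R[i]) :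
  exp_multiplier c K m -> exp_multiplier c K' n ->
  exp_multiplier c (K + cabs z * K') (fun t => m t + z * n t).
Proof.
move=> [mre mim mK] [nre nim nK]; split.
- rewrite (_ : (fun t : R => _) = fun t : R => complex.Re (m t) +
    (complex.Re z * complex.Re (n t) + - complex.Im z * complex.Im (n t))).
    move=> t; apply: cvgD; first exact: mre.
    by apply: cvgD; apply: cvgM; [exact: cvg_cst|exact: nre|exact: cvg_cst|exact: nim].
  by apply/funext => t; case: (z) (m t) (n t) => x y [? ?] [? ?]; simpc => /=; ring.
- rewrite (_ : (fun t : R => _) = fun t : R => complex.Im (m t) +
    (complex.Re z * complex.Im (n t) + complex.Im z * complex.Re (n t))).
    move=> t; apply: cvgD; first exact: mim.
    by apply: cvgD; apply: cvgM; [exact: cvg_cst|exact: nim|exact: cvg_cst|exact: nre].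
  by apply/funext => t; case: (z) (m t) (n t) => x y [? ?] [? ?]; simpc => /=; ring.
- move=> t t0; rewrite (le_trans (ler_cabsD _ _))// cabsM mulrDl lerD ?mK//.
  by rewrite -mulrA ler_wpM2l ?cabs_ge0 ?nK.
Qed.

Lemma exp_multiplier_cexp (R : realType) (lam : R[i]) (c : R) :
  c <= complex.Re lam -> exp_multiplier c 1 (fun t => cexp (- (lam * t%:C))).
Proof.
move=> cl; have [cre cim] := continuous_exp_trig lam; split=> // t t0.
by rewrite mul1r cabs_cexp_laplace ler_expR ler_wpM2r// lerN2.
Qed.

Lemma laplace_kernel_int (R : realType) (a : R -> R[i]) (lam : R[i]) :
  laplace a lam = kernel_int a (fun t => cexp (- (lam * t%:C))).
Proof. exact: laplaceE. Qed.

(** Half of the decay rate is given up to absorb the powers of t: t^2 e^(-3ct/4)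
    is O(e^(-ct/2)).  The remainder of the exponential is bounded by
    [cexp_taylor]. *)
Lemma laplace_taylor (R : realType) (a : R -> R[i]) (lam : R[i]) :
  L1loc a -> subexponential a -> 0 < complex.Re lam ->
  exists d Q, 0 <= Q /\ forall h, cabs h <= complex.Re lam / 4 ->
    cabs (laplace a (lam + h) - laplace a lam - h * d) <= Q * cabs h ^+ 2.
Proof.
set c := complex.Re lam => al asub c0.
have c2 : 0 < c / 2 by rewrite divr_gt0.
have c4 : 0 < c / 4 by rewrite divr_gt0.
pose m0 t := cexp (- (lam * t%:C)).
have M0 : exp_multiplier (c / 2) 1 m0.
  by apply: exp_multiplier_cexp; rewrite -/c; lra.
pose m1 t := - (t%:C * m0 t).
have [cre cim] := continuous_exp_trig lam.
have M1 : exp_multiplier (c / 2) (c / 2)^-1 m1.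
  split.
  - rewrite (_ : (fun t : R => _) = fun t : R => - t * complex.Re (m0 t)).
      by move=> t; apply: cvgM; [apply: cvgN; exact: cvg_id|exact: cre].
    by apply/funext => t; rewrite /m1; case: (m0 t) => ? ?; simpc => /=; ring.
  - rewrite (_ : (fun t : R => _) = fun t : R => - t * complex.Im (m0 t)).
      by move=> t; apply: cvgM; [apply: cvgN; exact: cvg_id|exact: cim].
    by apply/funext => t; rewrite /m1; case: (m0 t) => ? ?; simpc => /=; ring.
  - move=> t t0; rewrite /m1 cabsN cabsM cabs_real ger0_norm// cabs_cexp_laplace.
    rewrite (_ : - (c / 2) * t = c / 2 * t + - complex.Re lam * t); last first.
      by rewrite -/c; field.
    by rewrite expRD mulrA ler_wpM2r ?expR_ge0// id_le_expR.
pose N := intR (half (fun t => expR (- (c / 2) * t) * cabs (a t))).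
have N0 : 0 <= N.
  apply: Rintegral_ge0 => t _; rewrite /half; case: ifP => // _.
  by rewrite mulr_ge0 ?expR_ge0 ?cabs_ge0.
exists (kernel_int a m1), (2 * (4 * (4 / (c / 4) ^+ 2) * N)); split.
  by rewrite !mulr_ge0// invr_ge0 sqr_ge0.
move=> h hc.
pose mh t := cexp (- ((lam + h) * t%:C)).
have Mh : exp_multiplier (c / 2) 1 mh.
  apply: exp_multiplier_cexp.
  have -> : complex.Re (lam + h) = c + complex.Re h by rewrite /c; case: (lam) (h) => ? ? [].
  have := Re_le_cabs h; rewrite ler_norml => /andP[h1 _].
  by lra.
(* The remainder e^(-(lam+h)t) - e^(-lam t) + h t e^(-lam t). *)
pose mr t := mh t + (- 1) * (m0 t + h * m1 t).
have Mr := exp_multiplierZD (- 1) Mh (exp_multiplierZD h M0 M1).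
have -> : laplace a (lam + h) - laplace a lam - h * kernel_int a m1 = kernel_int a mr.
  rewrite (kernel_intZD _ al asub c2 Mh (exp_multiplierZD h M0 M1)).
  rewrite (kernel_intZD _ al asub c2 M0 M1) !laplace_kernel_int.
  by rewrite mulN1r opprD addrA.
have -> : 2 * (4 * (4 / (c / 4) ^+ 2) * N) * cabs h ^+ 2 =
   2 * ((4 * (4 / (c / 4) ^+ 2) * cabs h ^+ 2) * N) by ring.
apply: kernel_int_bound => //.
have [rre rim _] := Mr; split=> // t t0.
have -> : mr t = m0 t * (cexp (- (h * t%:C)) - 1 - - (h * t%:C)).
  rewrite /mr /mh /m1 mulrDl opprD cexpD -/(m0 t); ring.
rewrite cabsM cabs_cexp_laplace -/c.
have := cexp_taylor (- (h * t%:C)); rewrite cabsN cabsM cabs_real (ger0_norm t0).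
set r := cabs h in hc * => /(ler_wpM2l (expR_ge0 (- c * t))) /le_trans; apply.
have r0 : 0 <= r by exact: cabs_ge0.
have e1 : expR (r * t) <= expR (c / 4 * t) by rewrite ler_expR ler_wpM2r.
have e2 := sqr_le_expR c4 t0.
(* One e^(ct/4) pays for t^2, the other for e^(|h|t). *)
rewrite (_ : - (c / 2) * t = - c * t + (c / 4 * t + c / 4 * t)); last by field.
rewrite !expRD; set E := expR (c / 4 * t) in e1 e2 *.
set X := expR (- c * t); set F := expR (r * t) in e1 *.
have h2 : t ^+ 2 * F <= 4 / (c / 4) ^+ 2 * E * E.
  by rewrite ler_pM ?sqr_ge0 ?expR_ge0.
have p0 : 0 <= 4 * r ^+ 2 * X by rewrite !mulr_ge0 ?sqr_ge0 ?expR_ge0.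
have -> : X * (4 * ((r * t) ^+ 2 * F)) = 4 * r ^+ 2 * X * (t ^+ 2 * F) by ring.
have -> : 4 * (4 / (c / 4) ^+ 2) * r ^+ 2 * (X * (E * E)) =
  4 * r ^+ 2 * X * (4 / (c / 4) ^+ 2 * E * E) by ring.
exact: ler_wpM2l.
Qed.

Lemma is_derive_taylor (R : realType) (f : R -> R) (x l Q delta : R) :
  0 < delta -> 0 <= Q ->
  (forall h, `|h| <= delta -> `|f (x + h) - f x - h * l| <= Q * h ^+ 2) ->
  is_derive x 1 f l.
Proof.
move=> d0 Q0 fQ.
have cv : h^-1 *: (f (h *: 1 + x) - f x) @[h --> 0^'] --> l.
  apply/cvgrPdist_lt => e e0.
  near=> h.
  have h0 : h != 0 by near: h; exact: nbhs_dnbhs_neq.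
  have hd : `|h| <= delta.
    near: h; apply: nbhs_dnbhs; near=> h; apply: ltW; near: h.
    by have := @nbhs0_lt _ R^o _ d0.
  have he : `|h| < e / (Q + 1).
    near: h; apply: nbhs_dnbhs; near=> h; near: h.
    have e1 : 0 < e / (Q + 1) by rewrite divr_gt0// ltr_wpDl.
    by have := @nbhs0_lt _ R^o _ e1.
  have := fQ h hd; rewrite distrC /GRing.scale/= mulr1 (addrC h).
  have -> : h * l - (f (x + h) - f x) = h * (l - h^-1 * (f (x + h) - f x)).
    by rewrite mulrBr mulVKf.
  rewrite normrM -(real_normK (num_real h)) expr2 mulrCA.
  rewrite ler_pM2l ?normr_gt0// => /le_lt_trans; apply.
  apply: (@le_lt_trans _ _ ((Q + 1) * `|h|)).
    by rewrite ler_wpM2r// lerDl.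
  by rewrite mulrC -ltr_pdivlMr// ltr_wpDl.
apply: DeriveDef; first by apply/cvg_ex; exists l.
exact: (cvg_lim _ cv).
Unshelve. all: by end_near. Qed.

(** The derivative in the definition of regularity is a limit of difference
    quotients that need not exist a priori.  The Taylor bound shows that it
    does, and that it is the coefficient d. *)
Lemma laplace_derive1 (R : realType) (a : R -> R[i]) (lam : R[i]) :
  L1loc a -> subexponential a -> 0 < complex.Re lam ->
  exists Q, 0 <= Q /\ forall h, cabs h <= complex.Re lam / 4 ->
    cabs (laplace a (lam + h) - laplace a lam
          - h * derive1n 1 (laplace a : R[i] -> R[i]^o) lam) <= Q * cabs h ^+ 2.
Proof.
move=> al asub l0; have [d [Q [Q0 Qh]]] := laplace_taylor al asub l0.
exists Q; split=> //.
suff -> : derive1n 1 (laplace a : R[i] -> R[i]^o) lam = d by [].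
have l4 : 0 < (complex.Re lam / 4)%:C by rewrite ltcR divr_gt0.
apply: (@cvg_lim R[i]^o); first exact: norm_hausdorff.
apply/cvgrPdist_lt => e e0.
have [eE eR] : e = (complex.Re e)%:C /\ 0 < complex.Re e.
  by move: e0; rewrite ltcE/= => /andP[/eqP e1 e2]; split=> //; case: e e1 e2 => ? ? /= ->.
near=> h.
have h0 : h != 0 by near: h; exact: nbhs_dnbhs_neq.
have hd : cabs h <= complex.Re lam / 4.
  rewrite ltW// -ltcR -cabs_normE; near: h; apply: nbhs_dnbhs; near=> h; near: h.
  by have := @nbhs0_lt _ R[i]^o _ l4.
have he : cabs h < complex.Re e / (Q + 1).
  rewrite -ltcR -cabs_normE; near: h; apply: nbhs_dnbhs; near=> h; near: h.
  have e1 : 0 < (complex.Re e / (Q + 1))%:C by rewrite ltcR divr_gt0// ltr_wpDl.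
  by have := @nbhs0_lt _ R[i]^o _ e1.
have := Qh h hd.
set D := laplace a (lam + h) - laplace a lam => Dh.
rewrite (addrC h) -/D eE.
have hn : 0 < cabs h by rewrite cabs_gt0.
suff : cabs (d - h^-1 * D) < complex.Re e by rewrite -ltcR -cabs_normE.
rewrite -(ltr_pM2l hn) -cabsM mulrBr mulVKf// -cabsN opprB.
apply: (le_lt_trans Dh); rewrite expr2 mulrCA ltr_pM2l//.
apply: (@le_lt_trans _ _ ((Q + 1) * cabs h)).
  by rewrite ler_wpM2r ?cabs_ge0// lerDl.
by rewrite mulrC -ltr_pdivlMr// ltr_wpDl.
Unshelve. all: by end_near. Qed.

Definition laplace' (R : realType) (a : R -> R[i]) (lam : R[i]) : R[i] :=
  derive1n 1 (laplace a : R[i] -> R[i]^o) lam.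

Lemma ReM_real (R : realType) (z : R[i]) (r : R) :
  complex.Re (r%:C * z) = r * complex.Re z /\ complex.Im (r%:C * z) = r * complex.Im z.
Proof. by case: z => x y; simpc. Qed.

Lemma ReB (R : realType) (z w : R[i]) :
  complex.Re (z - w) = complex.Re z - complex.Re w /\
  complex.Im (z - w) = complex.Im z - complex.Im w.
Proof. by case: z w => x y [u v]; simpc. Qed.

(** Restricted to a line, the transform is a pair of real functions of a real
    variable, to which the mean value theorem and Gronwall's inequality apply. *)
Lemma laplace_line_derive (R : realType) (a : R -> R[i]) (lam v : R[i]) (x : R) :
  L1loc a -> subexponential a -> 0 < complex.Re (lam + x%:C * v) ->
  is_derive x 1 (fun t : R => complex.Re (laplace a (lam + t%:C * v)))
    (complex.Re (v * laplace' a (lam + x%:C * v))) /\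
  is_derive x 1 (fun t : R => complex.Im (laplace a (lam + t%:C * v)))
    (complex.Im (v * laplace' a (lam + x%:C * v))).
Proof.
move=> al asub; set mu := lam + x%:C * v => mu0.
have [Q [Q0 Qh]] := laplace_derive1 al asub mu0.
have d0 : 0 < complex.Re mu / 4 / (cabs v + 1).
  by rewrite !divr_gt0// ltr_wpDl// cabs_ge0.
have Q'0 : 0 <= Q * cabs v ^+ 2 by rewrite mulr_ge0// sqr_ge0.
have est h : `|h| <= complex.Re mu / 4 / (cabs v + 1) ->
   cabs (laplace a (lam + (x + h)%:C * v) - laplace a mu - h%:C * (v * laplace' a mu))
   <= Q * cabs v ^+ 2 * h ^+ 2.
  move=> hd.
  have hv : cabs (h%:C * v) = `|h| * cabs v by rewrite cabsM cabs_real.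
  have -> : lam + (x + h)%:C * v = mu + h%:C * v.
    by rewrite rmorphD/= mulrDl addrA.
  have := Qh (h%:C * v); rewrite hv exprMn real_normK ?num_real// => H.
  rewrite mulrA -[leRHS]mulrA [cabs v ^+ 2 * _]mulrC; apply: H.
  move: hd; rewrite ler_pdivlMr ?ltr_wpDl ?cabs_ge0//; apply: le_trans.
  by rewrite ler_wpM2l// lerDl.
split.
  apply: (is_derive_taylor d0 Q'0) => h hd.
  apply: le_trans (est h hd); apply: le_trans (Re_le_cabs _).
  by rewrite (ReB _ _).1 (ReB _ _).1 (ReM_real _ _).1.
apply: (is_derive_taylor d0 Q'0) => h hd.
apply: le_trans (est h hd); apply: le_trans (Im_le_cabs _).
by rewrite (ReB _ _).2 (ReB _ _).2 (ReM_real _ _).2.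
Qed.

Lemma gronwall (R : realType) (g dg : R -> R) (k : R) :
  (forall x : R, 0 <= x <= 1 -> is_derive x 1 g (dg x)) ->
  (forall x, 0 <= x <= 1 -> dg x <= k * g x) ->
  forall x, 0 <= x <= 1 -> g x <= expR (k * x) * g 0.
Proof.
move=> gd gk x /andP[x0 x1].
pose f y := expR (- k * y) * g y.
pose df y := - k * expR (- k * y) * g y + expR (- k * y) * dg y.
have fd (y : R) : 0 <= y <= 1 -> is_derive y 1 f (df y).
  by move=> y01; apply: is_derive_mul; [exact: is_derive_expM|exact: gd].
have [||c cx fE] := @MVT_segment R f df 0 x x0.
- move=> y; rewrite in_itv/= => /andP[y0 yx]; apply: fd.
  by rewrite (ltW y0)/= ltW// (lt_le_trans yx).
- apply: derivable_within_continuous => y; rewrite in_itv/= => /andP[y0 yx].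
  by have [] : is_derive y 1 f (df y) by apply: fd; rewrite y0 (le_trans yx).
have c01 : 0 <= c <= 1.
  by move: cx; rewrite in_itv/= => /andP[-> /le_trans]; apply.
have dc : df c <= 0.
  rewrite /df mulNr mulNr addrC -mulrA [k * _]mulrCA -mulrBr.
  by rewrite pmulr_rle0 ?expR_gt0// subr_le0 gk.
have : f x <= f 0.
  by rewrite -subr_le0 fE subr0 mulr_le0_ge0.
rewrite /f mulr0 expR0 mul1r mulNr => h.
by rewrite -(ler_pM2l (expR_gt0 (- (k * x)))) mulrA -expRD addNr expR0 mul1r.
Qed.

(** * Consequences of 1-regularity *)

Definition log_derivative_bound (R : realType) (a : R -> R[i]) (K : R) :=
  forall lam, 0 < complex.Re lam ->
    cabs lam * cabs (laplace' a lam) <= K * cabs (laplace a lam).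

Lemma Re_mul_le (R : realType) (z w : R[i]) :
  complex.Re z * complex.Re w + complex.Im z * complex.Im w <= cabs z * cabs w.
Proof.
have -> : complex.Re z * complex.Re w + complex.Im z * complex.Im w =
    complex.Re (z * conjc w).
  by case: z w => x y [u v]; simpc => /=.
have -> : cabs w = cabs (conjc w).
  by rewrite !cabsE; case: w => u v /=; rewrite sqrrN.
by rewrite -cabsM (le_trans (ler_norm _))// Re_le_cabs.
Qed.

(** On a segment that keeps distance rho from 0, the logarithmic derivative of the
    transform is at most K / rho, so that its size changes at most by the
    factor exp (K |v| / rho).  Gronwall's inequality is applied to the squared
    modulus, which is differentiable. *)
Lemma laplace_segment (R : realType) (a : R -> R[i]) (K rho : R) (lam v : R[i]) :
  L1loc a -> subexponential a -> 0 <= K -> log_derivative_bound a K -> 0 < rho ->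
  (forall x : R, 0 <= x <= 1 ->
     0 < complex.Re (lam + x%:C * v) /\ rho <= cabs (lam + x%:C * v)) ->
  let k := K * cabs v / rho in
  cabs (laplace a (lam + v)) <= expR k * cabs (laplace a lam) /\
  cabs (laplace a (lam + v) - laplace a lam) <=
    2 * (k * expR k * cabs (laplace a lam)).
Proof.
move=> al asub K0 aK rho0 seg k.
have k0 : 0 <= k by rewrite /k divr_ge0 ?mulr_ge0 ?cabs_ge0// ltW.
pose f x := laplace a (lam + x%:C * v).
pose f' x := v * laplace' a (lam + x%:C * v).
have f'f (x : R) : 0 <= x <= 1 -> cabs (f' x) <= k * cabs (f x).
  move=> /seg[re0 rh].
  have h : cabs (laplace' a (lam + x%:C * v)) <= K * cabs (f x) / rho.
    rewrite ler_pdivlMr// mulrC (le_trans _ (aK _ re0))//.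
    by rewrite ler_wpM2r ?cabs_ge0.
  rewrite /f' cabsM (le_trans (ler_wpM2l (cabs_ge0 v) h))//.
  by rewrite /k le_eqVlt; apply/orP; left; apply/eqP; ring.
have df (x : R) : 0 <= x <= 1 -> is_derive x 1 (fun t => complex.Re (f t)) (complex.Re (f' x)) /\
    is_derive x 1 (fun t => complex.Im (f t)) (complex.Im (f' x)).
  by move=> /seg[re0 _]; exact: laplace_line_derive.
have f1 : f 1 = laplace a (lam + v) by rewrite /f rmorph1 mul1r.
have f0 : f 0 = laplace a lam by rewrite /f rmorph0 mul0r addr0.
clearbody f f' k.
pose g x := complex.Re (f x) * complex.Re (f x) + complex.Im (f x) * complex.Im (f x).
have gE x : g x = cabs (f x) ^+ 2 by rewrite sqr_cabs /g -!expr2.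
pose dg x := complex.Re (f' x) * complex.Re (f x) + complex.Re (f x) * complex.Re (f' x)
  + (complex.Im (f' x) * complex.Im (f x) + complex.Im (f x) * complex.Im (f' x)).
have gd (x : R) : 0 <= x <= 1 -> is_derive x 1 g (dg x).
  move=> /df[d1 d2]; apply: is_derive_add; exact: is_derive_mul.
have gk (x : R) : 0 <= x <= 1 -> dg x <= (2 * k) * g x.
  move=> x01; have := Re_mul_le (f x) (f' x).
  have := ler_wpM2l (cabs_ge0 (f x)) (f'f x x01).
  by rewrite gE /dg expr2; lra.
have fk (x : R) : 0 <= x <= 1 -> cabs (f x) <= expR k * cabs (f 0).
  move=> x01; rewrite -(ler_pXn2r (n := 2))// ?nnegrE ?mulr_ge0 ?expR_ge0 ?cabs_ge0//.
  have := gronwall gd gk x01; rewrite !gE => /le_trans; apply.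
  rewrite exprMn ler_wpM2r ?sqr_ge0// -expRM_natl ler_expR.
  by case/andP: x01 => x0 x1; rewrite -mulrA ler_wpM2l// ler_piMr.
have one : 0 <= (1 : R) <= 1 by rewrite ler01 lexx.
split; first by rewrite -f1 -f0 fk.
have f'k (x : R) : 0 <= x <= 1 -> cabs (f' x) <= k * expR k * cabs (f 0).
  by move=> x01; rewrite (le_trans (f'f x x01))// -mulrA ler_wpM2l// fk.
rewrite -f1 -f0 (le_trans (cabs_le_ReIm _))// (mulrDl 1 1) mul1r.
rewrite (ReB _ _).1 (ReB _ _).2 lerD//.
  rewrite -[leRHS]mulr1 -[X in _ <= _ * X](subr0 1).
  apply: (@mvt_norm_le R (fun t => complex.Re (f t)) (fun t => complex.Re (f' t))) => //.
    by move=> x /df[].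
  by move=> x x01; rewrite (le_trans (Re_le_cabs _))// f'k.
rewrite -[leRHS]mulr1 -[X in _ <= _ * X](subr0 1).
apply: (@mvt_norm_le R (fun t => complex.Im (f t)) (fun t => complex.Im (f' t))) => //.
  by move=> x /df[].
by move=> x x01; rewrite (le_trans (Im_le_cabs _))// f'k.
Qed.

(** The chord from lam to |lam| stays in the half-plane Re > 0 and at distance at
    least |lam| / 2 from 0, and it is no longer than 2 |lam|. *)
Lemma laplace_chord (R : realType) (a : R -> R[i]) (K : R) (lam : R[i]) :
  L1loc a -> subexponential a -> 0 <= K -> log_derivative_bound a K ->
  0 < complex.Re lam ->
  cabs (laplace a (cabs lam)%:C) <= expR (4 * K) * cabs (laplace a lam).
Proof.
move=> al asub K0 aK l0; set r := cabs lam.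
have r0 : 0 < r by rewrite cabs_gt0; apply: contraTneq l0 => ->; rewrite ltxx.
have pr : complex.Re lam <= r by rewrite (le_trans (ler_norm _))// Re_le_cabs.
have r2 : r ^+ 2 = complex.Re lam ^+ 2 + complex.Im lam ^+ 2 := sqr_cabs lam.
have r20 : 0 < r / 2 by rewrite divr_gt0.
have [|h _] := @laplace_segment R a K (r / 2) lam (r%:C - lam) al asub K0 aK r20.
  move=> x /andP[x0 x1].
  have Ere : complex.Re (lam + x%:C * (r%:C - lam)) =
      (1 - x) * complex.Re lam + x * r.
    by rewrite /r; case: (lam) => p q; simpc => /=; ring.
  have Eim : complex.Im (lam + x%:C * (r%:C - lam)) = (1 - x) * complex.Im lam.
    by rewrite /r; case: (lam) => p q; simpc => /=; ring.
  split.
    rewrite Ere (@lt_le_trans _ _ (complex.Re lam))//.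
    rewrite mulrBl mul1r -addrA lerDl addrC -mulrBr mulr_ge0// subr_ge0//.
  rewrite -(ler_pXn2r (n := 2))// ?nnegrE ?cabs_ge0 ?(ltW r20)//.
  rewrite sqr_cabs Ere Eim.
  have h1 : 0 <= x * (1 - x) * (r * complex.Re lam).
    by rewrite !mulr_ge0 ?subr_ge0// ltW.
  have h2 : 0 <= r ^+ 2 * (2 * x - 1) ^+ 2 by rewrite mulr_ge0// sqr_ge0.
  have -> : ((1 - x) * complex.Re lam + x * r) ^+ 2 + ((1 - x) * complex.Im lam) ^+ 2
     = (1 - x) ^+ 2 * r ^+ 2 + x ^+ 2 * r ^+ 2 + 2 * (x * (1 - x) * (r * complex.Re lam)).
    rewrite [in RHS](_ : (1 - x) ^+ 2 * r ^+ 2 =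
      (1 - x) ^+ 2 * (complex.Re lam ^+ 2 + complex.Im lam ^+ 2)).
      by ring.
    by rewrite r2.
  have h3 : 0 <= r ^+ 2 by rewrite sqr_ge0.
  have -> : (r / 2) ^+ 2 = r ^+ 2 / 4 by field.
  have -> : (1 - x) ^+ 2 * r ^+ 2 + x ^+ 2 * r ^+ 2 = r ^+ 2 / 2 + r ^+ 2 * (2 * x - 1) ^+ 2 / 2.
    by field.
  by lra.
rewrite addrC subrK in h; apply: (le_trans h).
rewrite ler_wpM2r ?cabs_ge0// ler_expR ler_pdivrMr ?divr_gt0//.
have -> : 4 * K * (r / 2) = K * (2 * r) by field.
rewrite ler_wpM2l// (le_trans (ler_cabsB _ _))// cabs_real gtr0_norm//.
by rewrite (mulrDl 1 1) mul1r.
Qed.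

(** From lam + delta to lam the modulus never falls below |lam|, so the relative
    change is of order delta / |lam|.  This is the gain that makes the inverse
    Laplace integral converge. *)
Lemma laplace_shift (R : realType) (a : R -> R[i]) (K delta : R) (lam : R[i]) :
  L1loc a -> subexponential a -> 0 <= K -> log_derivative_bound a K ->
  0 < delta -> 0 < complex.Re lam -> delta <= cabs lam ->
  cabs (laplace a lam - laplace a (lam + delta%:C)) <=
    2 * K * expR K * (delta / cabs lam) * cabs (laplace a (lam + delta%:C)).
Proof.
move=> al asub K0 aK d0 l0 dl; set r := cabs lam.
have r0 : 0 < r by rewrite (lt_le_trans d0).
have [|_] := @laplace_segment R a K r (lam + delta%:C) (- delta%:C) al asub K0 aK r0.
  move=> x /andP[x0 x1].
  have xd : 0 <= (1 - x) * delta by rewrite mulr_ge0 ?subr_ge0// ltW.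
  have Ere : complex.Re (lam + delta%:C + x%:C * - delta%:C) =
      complex.Re lam + (1 - x) * delta.
    by case: (lam) => p q; simpc => /=; ring.
  have Eim : complex.Im (lam + delta%:C + x%:C * - delta%:C) = complex.Im lam.
    by case: (lam) => p q; simpc => /=; ring.
  split; first by rewrite Ere ltr_pwDl.
  rewrite /r !cabsE Ere Eim ler_wsqrtr// lerD2r ler_pXn2r ?nnegrE ?addr_ge0 ?(ltW l0)//.
  by rewrite lerDl.
rewrite addrK cabsN cabs_real (gtr0_norm d0) => h; apply: (le_trans h).
rewrite mulrA ler_wpM2r ?cabs_ge0// -!mulrA ler_wpM2l// ler_wpM2l//.
rewrite mulrA mulrC ler_wpM2r ?divr_ge0 ?(ltW d0) ?(ltW r0)// ler_expR.
by rewrite ler_piMr// ler_pdivrMr// mul1r.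
Qed.

(** * Bounds for H and for its differences *)

Definition resolvent_inverse (R : realType) (X : normedModType R[i])
    (A : unbounded_operator X) (b : R[i]) (P : X -> X) :=
  (forall x, dom A (P x) /\ P x - b *: A (P x) = x) /\
  (forall y, dom A y -> P (y - b *: A y) = y).

Lemma pinv_bij_inverse (R : realType) (X : normedModType R[i])
    (A : unbounded_operator X) (f : X -> X) :
  set_bij (dom A) setT f ->
  (forall x, dom A ('pinv_(fun=> 0) (dom A) f x) /\
     f ('pinv_(fun=> 0) (dom A) f x) = x) /\
  (forall y, dom A y -> 'pinv_(fun=> 0) (dom A) f (f y) = y).
Proof.
move=> [_ finj fsurj]; split=> [x|y Ay].
  split; last by apply: (surjpK (fun=> 0) fsurj); rewrite inE.
  by apply: (surjpinv_image_sub fsurj); exists x.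
by apply: (pinvKV (fun=> 0) finj); rewrite inE.
Qed.

Lemma parabolic_inverse (R : realType) (X : normedModType R[i])
    (A : unbounded_operator X) (a : R -> R[i]) (lam : R[i]) :
  parabolic A a -> 0 < complex.Re lam ->
  resolvent_inverse A (laplace a lam)
    ('pinv_(fun=> 0) (dom A) (fun y => y - laplace a lam *: A y)).
Proof.
move=> [/(_ lam) H _] /H[b0 [[_ finj fsurj] _]].
set b := laplace a lam in b0 finj fsurj *.
apply: (@pinv_bij_inverse _ _ _ (fun y => y - b *: A y)).
have E y : y - b *: A y = b *: (b^-1 *: y - A y).
  by rewrite scalerBr scalerA mulfV// scale1r.
split.
- by [].
- move=> x y Ax Ay; rewrite !E => /(scalerI b0); exact: finj.
- move=> x _; have [y Ay yx] := fsurj (b^-1 *: x) I.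
  by exists y => //; rewrite E yx scalerA mulfV// scale1r.
Qed.

Lemma unbounded_opB (R : realType) (X : normedModType R[i])
    (A : unbounded_operator X) x y : dom A x -> dom A y ->
  dom A (x - y) /\ A (x - y) = A x - A y.
Proof.
move=> Ax Ay; rewrite [x - y]addrC -scaleN1r; split; first exact: dom_linear.
by rewrite op_linear// addrC scaleN1r.
Qed.

Lemma unbounded_opZ (R : realType) (X : normedModType R[i])
    (A : unbounded_operator X) k x : dom A x ->
  dom A (k *: x) /\ A (k *: x) = k *: A x.
Proof.
have A00 : A 0 = 0.
  have := op_linear 1 (dom0 A) (dom0 A); rewrite scaler0 addr0 scale1r.
  by move/eqP; rewrite -subr_eq0 opprD addNKr oppr_eq0 => /eqP.
move=> Ax; rewrite -[k *: x]addr0; split; first exact: (dom_linear _ Ax (dom0 A)).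
by rewrite op_linear//; [rewrite A00 addr0|exact: dom0].
Qed.

Lemma resolvent_inverseZ (R : realType) (X : normedModType R[i])
    (A : unbounded_operator X) (b : R[i]) (P : X -> X) k x :
  resolvent_inverse A b P -> P (k *: x) = k *: P x.
Proof.
move=> [PA PK]; have [Ax Ex] := PA x.
have [Akx Ekx] := unbounded_opZ k Ax.
rewrite -{1}Ex scalerBr scalerA mulrC -scalerA -Ekx; exact: PK.
Qed.

Lemma opnorm_bound (R : realType) (V W : normedModType R[i]) (T : V -> W) (M : R) :
  (forall (k : R) x, T (k%:C *: x) = k%:C *: T x) ->
  (opnorm T <= M%:E)%E -> forall x, rnorm (T x) <= M * rnorm x.
Proof.
move=> TZ TM x; have [x0|x0] := eqVneq (rnorm x) 0.
  have -> : x = (0 : R)%:C *: x by rewrite (rnorm_eq0 x0) scaler0.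
  by rewrite TZ scale0r scale0r !rnorm0 mulr0.
have xp : 0 < rnorm x by rewrite lt_def x0 rnorm_ge0.
have : ((rnorm (T ((rnorm x)^-1%:C *: x)))%:E <= M%:E)%E.
  apply: le_trans TM; apply: ereal_sup_ubound; exists ((rnorm x)^-1%:C *: x) => //=.
  by rewrite rnormZr ger0_norm ?invr_ge0 ?rnorm_ge0// mulVf.
rewrite lee_fin TZ rnormZr ger0_norm ?invr_ge0 ?rnorm_ge0//.
by rewrite mulrC ler_pdivrMr.
Qed.

Lemma ereal_lty_bound (R : realType) (x : \bar R) : (x < +oo)%E ->
  exists2 M : R, 0 <= M & (x <= M%:E)%E.
Proof.
case: x => [r| |] // _; last by exists 0 => //; rewrite leNye.
by exists `|r| => //; rewrite lee_fin ler_norm.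
Qed.

Lemma graph_linearZ (R : realType) (X Y : normedModType R[i])
    (A : unbounded_operator X) (C : X -> Y) k y :
  graph_bounded_linear A C -> dom A y -> C (k *: y) = k *: C y.
Proof.
move=> [Clin _] Ay; have C0 : C 0 = 0.
  have := Clin 1 _ _ (dom0 A) (dom0 A); rewrite scaler0 addr0 scale1r.
  by move/eqP; rewrite -subr_eq0 opprD addNKr oppr_eq0 => /eqP.
by have := Clin k _ _ Ay (dom0 A); rewrite addr0 C0 addr0.
Qed.

Lemma graph_linearB (R : realType) (X Y : normedModType R[i])
    (A : unbounded_operator X) (C : X -> Y) x y :
  graph_bounded_linear A C -> dom A x -> dom A y -> C (x - y) = C x - C y.
Proof.
move=> [Clin _] Ax Ay; rewrite [x - y]addrC -scaleN1r Clin// scaleN1r.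
by rewrite addrC.
Qed.

(** The reciprocal of this weight is the decay assumed for C H on the positive
    half-line. *)
Definition weight (R : realType) (alpha r : R) : R :=
  (1 + logplus r) `^ alpha * r `^ 2^-1.

Lemma logplus_ge0 (R : realType) (r : R) : 0 <= logplus r.
Proof. by rewrite /logplus le_max lexx orbT. Qed.

Lemma weight_gt0 (R : realType) (alpha r : R) : 0 < r -> 0 < weight alpha r.
Proof.
by move=> r0; rewrite mulr_gt0 ?powR_gt0// ltr_wpDr// logplus_ge0.
Qed.

Lemma real_H_bound (R : realType) (X Y : normedModType R[i])
    (A : unbounded_operator X) (a : R -> R[i]) (C : X -> Y) (alpha : R) :
  parabolic A a -> graph_bounded_linear A C ->
  (ereal_sup [set opnorm (fun x : X =>
      ((1 + logplus r) `^ alpha * r `^ 2^-1)%:C *: C (Hop A a r%:C x))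
    | r in [set r : R | (0 < r)%R]] < +oo)%E ->
  exists2 B : R, 0 <= B & forall r x, 0 < r ->
    rnorm (C (Hop A a r%:C x)) <= B / weight alpha r * rnorm x.
Proof.
move=> par CL /ereal_lty_bound[B B0 HB]; exists B => // r x r0.
have w0 := weight_gt0 alpha r0.
have CZ k y : dom A y -> C (k *: y) = k *: C y := graph_linearZ k CL.
have rr : 0 < complex.Re r%:C by [].
have PP := parabolic_inverse par rr.
have := @opnorm_bound _ _ _ (fun x : X =>
  ((1 + logplus r) `^ alpha * r `^ 2^-1)%:C *: C (Hop A a r%:C x)) B.
rewrite -/(weight alpha r) => h.
have {h}/(_ x) : forall x, rnorm ((weight alpha r)%:C *: C (Hop A a r%:C x)) <= B * rnorm x.
  apply: h.
    move=> k y; rewrite /Hop (resolvent_inverseZ _ _ PP).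
    have [Ay _] := PP.1 y.
    rewrite [_^-1 *: (_ *: _)]scalerA !(CZ _ _ Ay) !scalerA; congr (_ *: _).
    by rewrite mulrA mulrC mulrA.
  apply: le_trans HB; apply: ereal_sup_ubound; by exists r.
rewrite rnormZr (gtr0_norm w0) => h.
by rewrite [leRHS]mulrAC ler_pdivlMr// mulrC.
Qed.

(** The vector w = lam H(lam) x is what the resolvent identities are written
    with. *)
Lemma H_scaleE (R : realType) (X : normedModType R[i])
    (A : unbounded_operator X) (a : R -> R[i]) (M : R) (lam : R[i]) (x : X) :
  parabolic A a -> 0 < complex.Re lam ->
  (opnorm (Hop A a lam) <= (M / cabs lam)%:E)%E ->
  exists w, [/\ dom A w, w - laplace a lam *: A w = x,
    Hop A a lam x = lam^-1 *: w & rnorm w <= M * rnorm x].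
Proof.
move=> par l0 HM; have PP := parabolic_inverse par l0.
have [Aw wx] := PP.1 x.
exists ('pinv_(fun=> 0) (dom A) (fun y => y - laplace a lam *: A y) x).
have r0 : 0 < cabs lam.
  by rewrite cabs_gt0; apply: contraTneq l0 => ->; rewrite ltxx.
split => //.
have HZ (k : R) y : Hop A a lam (k%:C *: y) = k%:C *: Hop A a lam y.
  by rewrite /Hop (resolvent_inverseZ _ _ PP) !scalerA mulrC.
have := opnorm_bound HZ HM x; rewrite /Hop rnormZ cabsV [leRHS]mulrAC.
by rewrite ler_pdivlMr// mulrAC mulVf ?mul1r// gt_eqF.
Qed.

(** With a^ the transform of the kernel and w = (I - a^(lam) A)^-1 x one has
    w = (I - a^(r) A)^-1 z for r = |lam| and
      z = w - (a^(r) / a^(lam)) (w - x),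
    so C H(lam) x and C H(r) z have the same norm.  The ratio of the transforms
    is bounded by [laplace_chord]. *)
Lemma complex_H_bound (R : realType) (X Y : normedModType R[i])
    (A : unbounded_operator X) (a : R -> R[i]) (C : X -> Y)
    (alpha B M K : R) (lam : R[i]) (x : X) :
  L1loc a -> subexponential a -> parabolic A a -> graph_bounded_linear A C ->
  0 <= K -> log_derivative_bound a K -> 0 <= B -> 0 <= M ->
  (forall r x, 0 < r -> rnorm (C (Hop A a r%:C x)) <= B / weight alpha r * rnorm x) ->
  (forall lam, 0 < complex.Re lam ->
    (opnorm (Hop A a lam) <= (M / cabs lam)%:E)%E) ->
  0 < complex.Re lam ->
  rnorm (C (Hop A a lam x)) <=
    B * (M + expR (4 * K) * (M + 1)) / weight alpha (cabs lam) * rnorm x.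
Proof.
move=> al asub par CL K0 aK B0 M0 CH HM l0.
set r := cabs lam.
have r0 : 0 < r.
  by rewrite cabs_gt0; apply: contraTneq l0 => ->; rewrite ltxx.
have rr : 0 < complex.Re r%:C by [].
have [w [Aw wx HE wM]] := H_scaleE x par l0 (HM _ l0).
have PP := parabolic_inverse par rr.
have b0 : laplace a lam != 0 by have [/(_ lam l0)[]] := par.
pose z := w - (laplace a r%:C / laplace a lam) *: (w - x).
have zE : z = w - laplace a r%:C *: A w.
  have AE : laplace a lam *: A w = w - x by rewrite -wx opprB addrC subrK.
  by rewrite /z -AE scalerA mulfVK.
have zM : rnorm z <= (M + expR (4 * K) * (M + 1)) * rnorm x.
  rewrite (le_trans (ler_rnormB _ _))// mulrDl lerD// rnormZ -mulrA.
  rewrite ler_pM ?cabs_ge0 ?rnorm_ge0//.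
    by rewrite cabsM cabsV ler_pdivrMr ?cabs_gt0// laplace_chord.
  by rewrite (le_trans (ler_rnormB _ _))// mulrDl mul1r lerD.
have E : rnorm (C (Hop A a lam x)) = rnorm (C (Hop A a r%:C z)).
  rewrite HE /Hop zE PP.2// !(graph_linearZ _ CL)// !rnormZ !cabsV.
  by rewrite cabs_real (gtr0_norm r0).
rewrite E (le_trans (CH r z r0))//.
rewrite [_ / weight _ _ * _]mulrAC [leRHS]mulrAC.
rewrite ler_wpM2r ?invr_ge0 ?(ltW (weight_gt0 _ r0))// -mulrA.
by rewrite ler_wpM2l.
Qed.

(** Let a^ be the transform of the kernel, nu = lam + delta, w = lam H(lam) x and
    v = nu H(nu) x.  The resolvent identity w - v = lam H(lam) z, with
      z = ((a^(lam) - a^(nu)) / a^(nu)) (v - x),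
    shows that the difference is (delta / nu) C H(lam) x + (lam / nu) C H(lam) z,
    and z is of order delta / |lam| by [laplace_shift]. *)
Lemma H_difference_bound (R : realType) (X Y : normedModType R[i])
    (A : unbounded_operator X) (a : R -> R[i]) (C : X -> Y)
    (alpha B M K delta : R) (lam : R[i]) (x : X) :
  L1loc a -> subexponential a -> parabolic A a -> graph_bounded_linear A C ->
  0 <= K -> log_derivative_bound a K -> 0 <= B -> 0 <= M ->
  (forall lam x, 0 < complex.Re lam ->
     rnorm (C (Hop A a lam x)) <= B / weight alpha (cabs lam) * rnorm x) ->
  (forall lam, 0 < complex.Re lam ->
    (opnorm (Hop A a lam) <= (M / cabs lam)%:E)%E) ->
  0 < delta -> 0 < complex.Re lam -> delta <= cabs lam ->
  rnorm (C (Hop A a lam x) - C (Hop A a (lam + delta%:C) x)) <=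
    B * (1 + 2 * K * expR K * (M + 1)) * (delta / cabs lam) /
      weight alpha (cabs lam) * rnorm x.
Proof.
move=> al asub par CL K0 aK B0 M0 CH HM d0 l0 dl.
set nu := lam + delta%:C; set r := cabs lam in dl *.
have r0 : 0 < r by rewrite (lt_le_trans d0).
have Rnu : complex.Re nu = complex.Re lam + delta by rewrite /nu; case: (lam).
have Inu : complex.Im nu = complex.Im lam.
  by rewrite /nu; case: (lam) => p q /=; rewrite addr0.
have n0 : 0 < complex.Re nu by rewrite Rnu addr_gt0.
have rn : r <= cabs nu.
  rewrite /r !cabsE Rnu Inu ler_wsqrtr// lerD2r ler_pXn2r ?nnegrE ?addr_ge0 ?(ltW l0) ?(ltW d0)//.
  by rewrite lerDl ltW.
have nu0 : nu != 0 by rewrite -cabs_gt0 (lt_le_trans r0).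
have lam0 : lam != 0 by rewrite -cabs_gt0.
have [w [Aw wx HEw wM]] := H_scaleE x par l0 (HM _ l0).
have [v [Av vx HEv vM]] := H_scaleE x par n0 (HM _ n0).
have PP := parabolic_inverse par l0.
have b0 : laplace a nu != 0 by have [/(_ nu n0)[]] := par.
have AE : laplace a nu *: A v = v - x by rewrite -vx opprB addrC subrK.
pose z := ((laplace a lam - laplace a nu) / laplace a nu) *: (v - x).
have zE : z = (w - v) - laplace a lam *: A (w - v).
  have -> : z = (laplace a lam - laplace a nu) *: A v.
    by rewrite /z -AE scalerA mulfVK.
  rewrite (unbounded_opB Aw Av).2 scalerBr opprB addrACA.
  rewrite [- v + _]addrC addrA.
  have -> : w + laplace a lam *: A v - laplace a lam *: A w - v =
     (w - laplace a lam *: A w) - v + laplace a lam *: A v.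
    by rewrite -!addrA; congr (_ + _); rewrite addrC -!addrA.
  by rewrite wx -(opprB v x) -AE scalerBl addrC.
have zM : rnorm z <= 2 * K * expR K * (delta / r) * (M + 1) * rnorm x.
  rewrite rnormZ -[leRHS]mulrA ler_pM ?cabs_ge0 ?rnorm_ge0//.
    by rewrite cabsM cabsV ler_pdivrMr ?cabs_gt0// laplace_shift.
  by rewrite (le_trans (ler_rnormB _ _))// mulrDl mul1r lerD.
have HzE : C (Hop A a lam z) = lam^-1 *: (C w - C v).
  rewrite /Hop zE PP.2; last exact: (unbounded_opB Aw Av).1.
  rewrite (graph_linearZ _ CL); last exact: (unbounded_opB Aw Av).1.
  by rewrite (graph_linearB CL).
have E : C (Hop A a lam x) - C (Hop A a nu x) =
    (delta%:C / nu) *: C (Hop A a lam x) + (lam / nu) *: C (Hop A a lam z).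
  rewrite HzE HEw HEv !(graph_linearZ _ CL)// !scalerA scalerBr addrA -scalerDl.
  congr (_ *: _ - _ *: _).
    rewrite (_ : delta%:C = nu - lam); last by rewrite /nu addrAC subrr add0r.
    by field; rewrite nu0 lam0.
  by field; rewrite nu0 lam0.
have b0' : 0 <= B / weight alpha r by rewrite divr_ge0// ltW// weight_gt0.
rewrite E (le_trans (ler_rnormD _ _))// !rnormZ !cabsM !cabsV cabs_real (gtr0_norm d0).
have h1 : delta / cabs nu * rnorm (C (Hop A a lam x)) <=
    delta / r * (B / weight alpha r * rnorm x).
  rewrite ler_pM ?divr_ge0 ?cabs_ge0 ?rnorm_ge0 ?(ltW d0)//; last exact: CH.
  by rewrite ler_wpM2l ?(ltW d0)// lef_pV2 ?posrE// (lt_le_trans r0).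
have h2 : r / cabs nu * rnorm (C (Hop A a lam z)) <=
    1 * (B / weight alpha r * (2 * K * expR K * (delta / r) * (M + 1) * rnorm x)).
  rewrite ler_pM ?divr_ge0 ?cabs_ge0 ?rnorm_ge0//.
    by rewrite ler_pdivrMr ?mul1r// (lt_le_trans r0).
  by rewrite (le_trans (CH _ z l0))// ler_wpM2l.
rewrite (le_trans (lerD h1 h2))// le_eqVlt; apply/orP; left; apply/eqP.
by move: (weight _ _)^-1 => u; ring.
Qed.

(** * The Laplace transform of the observed solution *)

(** C is bounded only on D(A), so psi o C is not a functional on X.  It becomes
    one after composition with P1 = (I - b A)^-1, where b is the transform of
    the kernel at 1: for y = x - b A x one has S(s) x = P1 S(s) y, hence
    psi (C S(s) x) = phi (S(s) y) with phi = psi o C o P1 bounded on X.  Then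
    [laplace_solution] applies to phi, and P1 commutes with H(lam). *)
Lemma observation_functional (R : realType) (X Y : normedModType R[i])
    (A : unbounded_operator X) (a : R -> R[i]) (S : R -> {linear X -> X})
    (C : X -> Y) (psi : Y -> R) (B BS : R) (x : X) :
  L1loc a -> subexponential a -> parabolic A a -> graph_bounded_linear A C ->
  solution_family A a S -> 0 <= B -> 0 <= BS ->
  (forall y, rnorm (C (Hop A a 1 y)) <= B * rnorm y) ->
  (forall t y, 0 <= t -> rnorm (S t y) <= BS * rnorm y) ->
  real_linear psi -> (forall y, `|psi y| <= rnorm y) -> dom A x ->
  {within `[0, +oo[, continuous (fun s => psi (C (S s x)))} /\
  forall lam, 0 < complex.Re lam ->
    L1 (half (fun s => psi (cexp (- (lam * s%:C)) *: C (S s x)))) /\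
    intR (half (fun s => psi (cexp (- (lam * s%:C)) *: C (S s x)))) =
      psi (C (Hop A a lam x)).
Proof.
move=> al asub par CL Ssol B0 BS0 CH SB psiL psi1 Ax.
have [_ S0 Sc SA Seq] := Ssol.
have one0 : 0 < complex.Re (1 : R[i]) by exact: ltr01.
have [P1A P1K] := parabolic_inverse par one0.
set b := laplace a 1 in P1A P1K.
set P1 := 'pinv_(fun=> 0) (dom A) (fun y => y - b *: A y) in P1A P1K.
have P1Z k z : P1 (k *: z) = k *: P1 z.
  exact: (resolvent_inverseZ _ _ (conj P1A P1K)).
have P1D z w : P1 (z + w) = P1 z + P1 w.
  have [Az Ez] := P1A z; have [Aw Ew] := P1A w.
  have Azw : dom A (P1 z + P1 w).
    by rewrite -[P1 z]scale1r; exact: dom_linear.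
  rewrite -[RHS]P1K// -[P1 z]scale1r op_linear// !scale1r scalerDr opprD addrACA.
  by rewrite Ez Ew.
pose y := x - b *: A x.
pose phi z := psi (C (P1 z)).
have phiL : real_linear phi.
  split=> [z w|k z].
    rewrite /phi P1D -{1}[P1 z]scale1r CL.1 ?scale1r ?psiL.1//.
      exact: (P1A z).1.
    exact: (P1A w).1.
  by rewrite /phi P1Z (graph_linearZ _ CL) ?psiL.2//; exact: (P1A z).1.
have phiZ k z : phi (k *: z) = psi (k *: C (P1 z)).
  by rewrite /phi P1Z (graph_linearZ _ CL)//; exact: (P1A z).1.
have k0 : 0 < B + 1 by rewrite ltr_wpDl.
have phik z : `|phi z| <= (B + 1) * rnorm z.
  rewrite (le_trans (psi1 _))// mulrDl mul1r.
  apply: ler_wpDr; first exact: rnorm_ge0.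
  by have := CH z; rewrite /Hop invr1 scale1r.
have SE s : 0 <= s -> P1 (S s y) = S s x.
  move=> s0; have [ASx ASE] := SA s x s0 Ax.
  by rewrite /y linearB linearZ/= -ASE P1K.
have phiE s k : 0 <= s -> phi (k *: S s y) = psi (k *: C (S s x)).
  by move=> s0; rewrite phiZ SE.
split.
  have cphi : {within `[0, +oo[, continuous (fun s => phi (S s y))}.
    move=> s.
    apply: (@continuous_comp (subspace (`[0, +oo[%classic : set R)) X R (S ^~ y) phi).
      exact: Sc.
    exact: (functional_continuous phiL k0 phik).
  apply: subspace_eq_continuous cphi => s; rewrite inE/= in_itv/= andbT => s0.
  by have := phiE s 1 s0; rewrite !scale1r.
move=> lam l0.
have E : half (fun s => psi (cexp (- (lam * s%:C)) *: C (S s x))) =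
         half (fun s => phi (cexp (- (lam * s%:C)) *: S s y)).
  by apply/funext => s; rewrite /half; case: ifP => // s0; rewrite phiE.
rewrite E; split.
  have [] := @orbit_L1 R X (fun s => S s y) phi (B + 1) (BS * rnorm y) lam phiL k0
    phik (Sc y) (fun t t0 => SB t y t0) l0.
  by [].
have [PA PK] := parabolic_inverse par l0.
set c := laplace a lam in PA PK.
rewrite /Hop -/c.
set P := 'pinv_(fun=> 0) (dom A) (fun y => y - c *: A y) in PA PK *.
have [APy EPy] := PA y.
rewrite -{1}EPy.
rewrite (laplace_solution al asub Ssol SB phiL k0 phik l0 APy).
rewrite phiZ (graph_linearZ _ CL); last exact: (PA x).1.
congr (psi (_ *: C _)).
(* The inverses P1 and P commute: P y = q with P1 q = u. *)
pose u := P x; have [Au Eu] := PA x.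
have c0 : c != 0 by have [/(_ lam l0)[]] := par.
have AuE : A u = c^-1 *: (u - x).
  by rewrite -[in RHS]Eu opprB addrC subrK scalerA mulVf// scale1r.
have AAu : dom A (A u).
  by rewrite AuE; apply: (unbounded_opZ _ _).1; exact: (unbounded_opB _ _).1.
have [AcAu EcAu] := unbounded_opZ c AAu.
have [AbAu EbAu] := unbounded_opZ b AAu.
pose q := u - b *: A u.
have [Aq Eq] := unbounded_opB Au AbAu.
have qy : q - c *: A q = y.
  have Ax' : A x = A u - c *: A (A u) by rewrite -EcAu -(unbounded_opB Au AcAu).2 Eu.
  rewrite /q Eq EbAu /y Ax' -{2}Eu -/u !scalerBr !opprB !scalerA [c * b]mulrC.
  by rewrite [X in _ + X = _]addrC addrACA [X in _ + X = _]addrC.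
by rewrite -qy PK// P1K.
Qed.

(** * From the Laplace transform to pointwise decay *)

Lemma cexp_polar (R : realType) (p q : R) :
  cexp (p +i* q) = (expR p * cos q) +i* (expR p * sin q).
Proof. by rewrite /cexp /=; simpc. Qed.

Lemma cexp_phase (R : realType) (delta s t u : R) :
  cexp (0 +i* (s * t)) * cexp (- ((delta +i* s) * u%:C)) =
  (expR (- delta * u) * cos (s * (t - u))) +i*
  (expR (- delta * u) * sin (s * (t - u))).
Proof.
rewrite -cexpD -cexp_polar; congr cexp; simpc.
by congr (_ +i* _); ring.
Qed.

Lemma functional_phase (R : realType) (V : lmodType R[i]) (psi : V -> R)
    (delta s t u : R) (y : V) : real_linear psi ->
  psi (cexp (0 +i* (s * t)) *: (cexp (- ((delta +i* s) * u%:C)) *: y)) =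
  expR (- delta * u) * cos (s * (t - u)) * psi y +
  expR (- delta * u) * sin (s * (t - u)) * psi ('i *: y).
Proof.
by move=> psiL; rewrite scalerA cexp_phase (real_linear_scale _ _ psiL).
Qed.

Lemma half_continuous_at (R : realType) (f : R -> R) (t : R) : 0 < t ->
  {within `[0, +oo[, continuous f} -> {for t, continuous (half f)}.
Proof.
move=> t0 /continuous_within_itvcyP[cf _].
have ct : {for t, continuous f} by apply: cf; rewrite in_itv/= andbT.
rewrite /prop_for /continuous_at {2}/half (ltW t0).
apply: cvg_trans ct; apply: near_eq_cvg; near=> u; rewrite /half.
suff -> : 0 <= u by [].
apply: ltW; near: u; exact: lt_nbhsr.
Unshelve. all: by end_near. Qed.

(** Let psi be norming for g(t), t = 1/delta, and
    H(u) = (e^(-delta u) - e^(-2 delta u)) psi(g(u)).  Averaging the transforms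
    at delta + i s and delta - i s, with the phases e^(ist) and e^(-ist), gives
    the cosine transform of H centred at t, and G bounds it.  The values of L
    enter only through differences at distance delta, because of the
    difference of exponentials in H. *)
Lemma decay_from_laplace (R : realType) (Y : normedModType R[i])
    (g : R -> Y) (L : R[i] -> Y) (G : R -> R) (delta : R) :
  (forall psi : Y -> R, real_linear psi -> (forall y, `|psi y| <= rnorm y) ->
    {within `[0, +oo[, continuous (psi \o g)} /\
    forall lam, 0 < complex.Re lam ->
      L1 (half (fun s => psi (cexp (- (lam * s%:C)) *: g s))) /\
      intR (half (fun s => psi (cexp (- (lam * s%:C)) *: g s))) = psi (L lam)) ->
  0 < delta -> L1 (half G) ->
  (forall s, 0 <= s ->
    rnorm (L (delta +i* s) - L ((delta +i* s) + delta%:C)) <= G s /\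
    rnorm (L (delta +i* (- s)) - L ((delta +i* (- s)) + delta%:C)) <= G s) ->
  (expR (- 1) - expR (- 2)) * rnorm (g delta^-1) <= 2 * intR (half G).
Proof.
move=> gL d0 iG LG; set t := delta^-1.
have t0 : 0 < t by rewrite invr_gt0.
have td : delta * t = 1 by rewrite /t mulfV// gt_eqF.
clearbody t.
have [psi [psiL psi1 psit]] := norming_functional (g t).
pose w u := expR (- delta * u) - expR (- (delta + delta) * u).
pose H := half (fun u => w u * psi (g u)).
pose F z lam := half (fun u => psi (z *: (cexp (- (lam * u%:C)) *: g u))).
have FE z lam : cabs z = 1 -> 0 < complex.Re lam ->
    L1 (F z lam) /\ intR (F z lam) = psi (z *: L lam).
  move=> z1 l0; apply: (gL (fun y => psi (z *: y)) _ _).2 => //.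
    exact: real_linear_comp_scale.
  by move=> y; rewrite (le_trans (psi1 _))// rnormZ z1 mul1r.
have z1 (q : R) : cabs (cexp (0 +i* q)) = 1 by rewrite cabs_cexp expR0.
have HE s : (fun u => H u * cos (s * (t - u))) = fun u =>
   2^-1 * ((F (cexp (0 +i* (s * t))) (delta +i* s) u +
            - 1 * F (cexp (0 +i* (s * t))) ((delta +i* s) + delta%:C) u) +
           (F (cexp (0 +i* (- s * t))) (delta +i* (- s)) u +
            - 1 * F (cexp (0 +i* (- s * t))) ((delta +i* (- s)) + delta%:C) u)).
  apply/funext => u; rewrite /H /F /half; case: ifP => _; last first.
    by rewrite mul0r !mulr0 !addr0 mulr0.
  have -> : (delta +i* s) + delta%:C = (delta + delta) +i* s by simpc.
  have -> : (delta +i* (- s)) + delta%:C = (delta + delta) +i* (- s) by simpc.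
  (* The unwanted sine terms cancel between s and - s. *)
  pose X d q := expR (- d * u) * cos (q * (t - u)) * psi (g u) +
    expR (- d * u) * sin (q * (t - u)) * psi ('i *: g u).
  transitivity (2^-1 * ((X delta s + - 1 * X (delta + delta) s) +
     (X delta (- s) + - 1 * X (delta + delta) (- s)))).
    by rewrite /X [- s * _]mulNr cosN sinN /w; field.
  by congr (_ * ((_ + _ * _) + (_ + _ * _))); apply/esym; exact: functional_phase.
have HB s : 0 <= s -> L1 (fun u => H u * cos (s * (t - u))) /\
    `|intR (fun u => H u * cos (s * (t - u)))| <= G s.
  move=> s0; rewrite HE.
  have Rd (b : R) : 0 < complex.Re (delta +i* b) by [].
  have Rdd (b : R) : 0 < complex.Re ((delta +i* b) + delta%:C).
    by simpc => /=; rewrite addr_gt0.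
  have [i1 E1] := FE _ _ (z1 (s * t)) (Rd s).
  have [i2 E2] := FE _ _ (z1 (s * t)) (Rdd s).
  have [i3 E3] := FE _ _ (z1 (- s * t)) (Rd (- s)).
  have [i4 E4] := FE _ _ (z1 (- s * t)) (Rdd (- s)).
  have i2' := L1Z (- 1) i2; have i4' := L1Z (- 1) i4.
  have i12 := L1D i1 i2'; have i34 := L1D i3 i4'.
  split; first exact: L1Z (L1D i12 i34).
  rewrite (intRZ _ (L1D i12 i34)) (intRD i12 i34) (intRD i1 i2') (intRD i3 i4').
  rewrite (intRZ _ i2) (intRZ _ i4) E1 E2 E3 E4 !mulN1r.
  rewrite -!(real_linearB _ _ psiL) -!scalerBr.
  rewrite normrM gtr0_norm ?invr_gt0// mulrC ler_pdivrMr//.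
  rewrite (le_trans (ler_normD _ _))// mulrDr mulr1 lerD//.
    by rewrite (le_trans (psi1 _))// rnormZ z1 mul1r (LG s s0).1.
  by rewrite (le_trans (psi1 _))// rnormZ z1 mul1r (LG s s0).2.
have iH : L1 H.
  have [] := HB 0 (lexx 0).
  by under [X in L1 X -> _]eq_fun do rewrite mul0r cos0 mulr1.
have cH : {for t, continuous H}.
  apply: half_continuous_at => //.
  have cg := (gL psi psiL psi1).1.
  have cw : continuous w.
    move=> u; apply: cvgB.
      exact: (derivable_continuous (is_derive_expM (- delta))).
    exact: (derivable_continuous (is_derive_expM (- (delta + delta)))).
  move=> u; apply: cvgM; last exact: cg.
  by have := continuous_subspaceT cw; apply.
have := cosine_inversion_le iH cH iG (fun s s0 => (HB s s0).2).
rewrite {1}/H /half (ltW t0) psit /w.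
have -> : - delta * t = - 1 by rewrite mulNr td.
have -> : - (delta + delta) * t = - 2.
  by transitivity (- (delta * t) * 2); [ring|rewrite td; ring].
by [].
Qed.

(** * The two weight integrals *)

Lemma powR_inv_half (R : realType) (m : R) : 0 < m ->
  m^-1 * (m `^ 2^-1)^-1 = m `^ (- 2^-1 - 1).
Proof.
move=> m0; rewrite powRD; last by apply/implyP => _; rewrite gt_eqF.
by rewrite !powRN powRr1 ?(ltW m0)// mulrC.
Qed.

(** The mean (delta + s) / 2 will replace the modulus |delta + i s|, which it
    bounds from below; its power -3/2 has an elementary primitive. *)
Lemma half_power_integral (R : realType) (delta : R) : 0 < delta ->
  let m := fun s : R => (delta + s) / 2 in
  L1 (half (fun s => (m s)^-1 * (m s `^ 2^-1)^-1)) /\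
  intR (half (fun s => (m s)^-1 * (m s `^ 2^-1)^-1)) =
    4 * ((delta / 2) `^ 2^-1)^-1.
Proof.
move=> d0 m.
have m0 s : 0 <= s -> 0 < m s by move=> s0; rewrite divr_gt0// ltr_pwDl.
have dm (s : R) : is_derive s 1 m 2^-1.
  rewrite (_ : m = fun s => delta / 2 + 2^-1 * s).
    by rewrite -[X in is_derive _ _ _ X]add0r; apply: is_derive_add; exact: is_derive_linear.
  by apply/funext => y; rewrite /m mulrDl [y / 2]mulrC.
have dp (b s : R) : 0 <= s ->
    is_derive s 1 (fun s => m s `^ b) (b * m s `^ (b - 1) * 2^-1).
  move=> s0; apply: (@is_derive1_comp R (fun y => y `^ b) m).
  by apply: is_derive1_powR; exact: m0.
have halfE : half (fun s => (m s)^-1 * (m s `^ 2^-1)^-1) =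
    half (fun s => m s `^ (- 2^-1 - 1)).
  apply/funext => s; rewrite /half; case: ifP => // s0.
  by rewrite powR_inv_half// m0.
rewrite halfE.
have F0 : - 4 * m s `^ (- 2^-1) @[s --> +oo] --> 0.
  rewrite -[X in _ --> X](mulr0 (- 4)); apply: cvgMr.
  apply/cvgrPdist_lt => e e0; near=> s.
  have s0 : 0 <= s by near: s; apply: nbhs_pinfty_ge; rewrite num_real.
  have sm : 2 * (e ^- 2) < s by near: s; apply: nbhs_pinfty_gt; rewrite num_real.
  rewrite sub0r normrN ger0_norm ?powR_ge0// powRN.
  have mp : 0 < m s `^ 2^-1 by rewrite powR_gt0// m0.
  rewrite invf_plt ?posrE//.
  rewrite -(ltr_pXn2r (n := 2))// ?nnegrE ?invr_ge0 ?powR_ge0 ?(ltW e0)//.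
  rewrite -(powR_mulrn 2 (powR_ge0 _ _)) -powRrM mulVf// powRr1 ?(ltW (m0 _ s0))//.
  by rewrite exprVn /m ltr_pdivlMr// mulrC (lt_le_trans sm)// lerDr ltW.
have f0 s : 0 <= s -> 0 <= m s `^ (- 2^-1 - 1) by move=> _; exact: powR_ge0.
have fc : {within `[0, +oo[, continuous (fun s => m s `^ (- 2^-1 - 1))}.
  apply: derivable_within_continuous => s; rewrite in_itv/= andbT => s0.
  by have [] := dp (- 2^-1 - 1) s s0.
have fd (s : R) : 0 <= s ->
    is_derive s 1 (fun s => - 4 * m s `^ (- 2^-1)) (m s `^ (- 2^-1 - 1)).
  move=> s0; have h := is_derive_mul (is_derive_cst (- 4 : R) s 1) (dp (- 2^-1) s s0).
  by apply: (is_derive_eq h); rewrite mul0r add0r /=; field.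
have [i ->] := ge0_FTC_half f0 fc fd F0.
by split=> //; rewrite mulNr opprK powRN /m addr0.
Unshelve. all: by end_near. Qed.

(** The square of the decay rate of C S, up to constants. *)
Definition log_profile (R : realType) (alpha r : R) : R :=
  r^-1 * ((1 + logplus r^-1) `^ (2 * alpha))^-1.

(** On [e, 1] the profile is r^-1 (1 - ln r)^(-b) with b = 2 alpha > 1, the
    derivative of (b - 1)^-1 (1 - ln r)^(1 - b); the bound does not depend on
    e. *)
Lemma log_profile_integral (R : realType) (alpha e : R) :
  2^-1 < alpha -> 0 < e -> e < 1 ->
  L1 (log_profile alpha \_ `[e, 1]) /\
  intR (log_profile alpha \_ `[e, 1]) <= (2 * alpha - 1)^-1.
Proof.
move=> al e0 e1; set b := 2 * alpha.
have b1 : 0 < b - 1 by rewrite subr_gt0 /b mulrC -ltr_pdivrMr// mul1r.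
pose f (r : R) := r^-1 * (1 - ln r) `^ (- b).
pose F (r : R) := (b - 1)^-1 * (1 - ln r) `^ (1 - b).
have lnp r : e <= r <= 1 -> 0 < 1 - ln r.
  by move=> /andP[er r1]; rewrite ltr_pwDl// oppr_ge0 ln_le0.
have kf r : e <= r <= 1 -> log_profile alpha r = f r.
  move=> /andP[er r1]; have r0 : 0 < r by rewrite (lt_le_trans e0).
  rewrite /log_profile /f powRN /logplus lnV ?posrE// max_l//.
  by rewrite oppr_ge0 ln_le0.
have dl (r : R) : e <= r <= 1 -> is_derive r 1 (fun r => 1 - ln r) (- r^-1).
  move=> /andP[er _]; have r0 : 0 < r by rewrite (lt_le_trans e0).
  by rewrite -[X in is_derive _ _ _ X]add0r; apply: is_deriveB; exact: is_derive1_ln.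
have dp (c r : R) : e <= r <= 1 -> is_derive r 1 (fun r => (1 - ln r) `^ c)
    (c * (1 - ln r) `^ (c - 1) * - r^-1).
  move=> rr; apply: (@is_derive1_comp R (fun y => y `^ c) (fun r => 1 - ln r)).
    by apply: is_derive1_powR; exact: lnp.
  exact: dl.
have dF (r : R) : e <= r <= 1 -> is_derive r 1 F (f r).
  move=> rr; have h := is_derive_mul (is_derive_cst (b - 1)^-1 r 1) (dp (1 - b) r rr).
  have r0 : r != 0 by case/andP: rr => er _; rewrite gt_eqF// (lt_le_trans e0).
  apply: (is_derive_eq h); rewrite mul0r add0r /f /=.
  have -> : 1 - b - 1 = - b by ring.
  by field; rewrite r0/= subr_eq0; rewrite -subr_eq0 gt_eqF.
have cf : {within `[e, 1], continuous f}.
  apply: derivable_within_continuous => r; rewrite in_itv/= => rr.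
  have r0 : r != 0 by case/andP: rr => er _; rewrite gt_eqF// (lt_le_trans e0).
  have dv : is_derive r 1 (fun r : R => r^-1) (- r ^- 2 *: 1).
    exact: is_deriveV.
  by have [] := is_derive_mul dv (dp (- b) r rr).
have int : (\int[@lebesgue_measure R]_(x in `[e, 1%R]) (f x)%:E = (F 1)%:E - (F e)%:E)%E.
  apply: continuous_FTC2 => //.
  - split.
    + move=> r; rewrite in_itv/= => /andP[er r1].
      by have [] : is_derive r 1 F (f r) by apply: dF; rewrite !ltW.
    + apply: cvg_at_right_filter; apply: differentiable_continuous.
      apply/derivable1_diffP; have [] // : is_derive e 1 F (f e).
      by apply: dF; rewrite lexx ltW.
    + apply: cvg_at_left_filter; apply: differentiable_continuous.
      apply/derivable1_diffP; have [] // : is_derive (1 : R) 1 F (f 1).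
      by apply: dF; rewrite lexx ltW.
  - move=> r; rewrite in_itv/= => /andP[er r1]; rewrite derive1E.
    by have [_ ->] : is_derive r 1 F (f r) by apply: dF; rewrite !ltW.
have kfE : log_profile alpha \_ `[e, 1] = f \_ `[e, 1].
  apply/funext => r; rewrite !patchE; case: ifPn => //.
  by rewrite inE/= in_itv/= => /kf.
rewrite kfE; split.
  apply/L1_itv; apply: continuous_compact_integrable => //.
  exact: segment_compact.
rewrite /intR -Rintegral_mkcond /Rintegral int -EFinB/= /F ln1 subr0 powR1 mulr1.
by rewrite lerBlDr lerDl mulr_ge0 ?powR_ge0// invr_ge0 ltW.
Qed.


(** * Pointwise decay and admissibility *)

Lemma modulus_ge_mean (R : realType) (delta b s : R) :
  0 < delta -> 0 <= s -> `|b| = s ->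
  delta <= cabs (delta +i* b) /\ (delta + s) / 2 <= cabs (delta +i* b).
Proof.
move=> d0 s0 bs.
have h1 := Re_le_cabs (delta +i* b); have h2 := Im_le_cabs (delta +i* b).
rewrite /= in h1 h2; rewrite (gtr0_norm d0) in h1; rewrite bs in h2.
by split=> //; lra.
Qed.

Lemma weight_ge (R : realType) (alpha delta m r : R) :
  0 <= alpha -> 0 < m -> m <= r -> 0 < delta -> delta <= r ->
  (1 + logplus delta) `^ alpha * m `^ 2^-1 <= weight alpha r.
Proof.
move=> a0 m0 mr d0 dr; rewrite ler_pM ?powR_ge0//.
  rewrite ge0_ler_powR// ?nnegrE ?addr_ge0 ?logplus_ge0// lerD2l.
  rewrite /logplus ge_max; apply/andP; split; last by rewrite le_max lexx orbT.
  by rewrite le_max ler_ln ?posrE ?dr// (lt_le_trans d0).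
by rewrite ge0_ler_powR// ?nnegrE ?ltW// (lt_le_trans m0).
Qed.

(** [decay_from_laplace] on the line Re lambda = delta = 1/t.  The majorant G is
    [H_difference_bound] with |lambda| replaced by (delta + s) / 2, except in the
    logarithm, where |lambda| is replaced by delta. *)
Lemma observation_decay (R : realType) (X Y : normedModType R[i])
    (A : unbounded_operator X) (a : R -> R[i]) (S : R -> {linear X -> X})
    (C : X -> Y) (alpha : R) :
  L1loc a -> subexponential a -> regular 1 a -> parabolic A a ->
  solution_family A a S -> bounded_family S -> graph_bounded_linear A C ->
  0 <= alpha ->
  (ereal_sup [set opnorm (fun x : X =>
      ((1 + logplus r) `^ alpha * r `^ 2^-1)%:C *: C (Hop A a r%:C x))
    | r in [set r : R | (0 < r)%R]] < +oo)%E ->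
  exists2 N, 0 <= N & forall t x, 0 < t -> dom A x ->
    rnorm (C (S t x)) ^+ 2 <= N * log_profile alpha t * rnorm x ^+ 2.
Proof.
move=> al asub [K K0 areg] par Ssol Sbd CL a0 CH.
have aK : log_derivative_bound a K.
  by move=> lam l0; rewrite -cabsM; exact: (areg 1%N lam _ l0).
have [_ [M M0 HM]] := par.
have [B B0 HB] := real_H_bound par CL CH.
have [BS BS0 SB'] := ereal_lty_bound Sbd.
have SB t y : 0 <= t -> rnorm (S t y) <= BS * rnorm y.
  move=> t0; apply: opnorm_bound; first by move=> k z; rewrite linearZ.
  apply: le_trans SB'; apply: ereal_sup_ubound; exists t => //=.
  by rewrite in_itv/= t0.
have HC lam x : 0 < complex.Re lam -> _ :=
  complex_H_bound x al asub par CL (ltW K0) aK B0 (ltW M0) HB HM.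
set B1 := B * (M + expR (4 * K) * (M + 1)) in HC.
have B10 : 0 <= B1.
  by rewrite mulr_ge0// addr_ge0 ?(ltW M0)// mulr_ge0 ?expR_ge0// addr_ge0 ?(ltW M0).
have HD delta lam x : 0 < delta -> 0 < complex.Re lam -> delta <= cabs lam -> _ :=
  H_difference_bound x al asub par CL (ltW K0) aK B10 (ltW M0) HC HM.
set N1 := B1 * (1 + 2 * K * expR K * (M + 1)) in HD.
have N10 : 0 <= N1.
  by rewrite mulr_ge0// addr_ge0// !mulr_ge0 ?expR_ge0 ?addr_ge0 ?(ltW M0) ?(ltW K0).
clearbody B1 N1.
pose c : R := expR (- 1) - expR (- 2).
have c0 : 0 < c by rewrite subr_gt0 ltr_expR; lra.
exists (2 * (8 * N1 / c) ^+ 2); first by rewrite mulr_ge0// sqr_ge0.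
move=> t x t0 Ax; set delta := t^-1.
have d0 : 0 < delta by rewrite invr_gt0.
set Ld := (1 + logplus delta) `^ alpha.
have Ld0 : 0 < Ld by rewrite powR_gt0// ltr_wpDr// logplus_ge0.
have [ik Ik] := half_power_integral d0.
set kappa := (fun s : R => _) in ik Ik.
pose G s := N1 * delta / Ld * rnorm x * kappa s.
have GE : half G = fun s => N1 * delta / Ld * rnorm x * half kappa s.
  by apply/funext => s; rewrite /half; case: ifP => // _; rewrite mulr0.
have iG : L1 (half G) by rewrite GE; exact: L1Z.
have LG (b s : R) : 0 <= s -> `|b| = s ->
   rnorm (C (Hop A a (delta +i* b) x) -
          C (Hop A a ((delta +i* b) + delta%:C) x)) <= G s.
  move=> s0 bs; have [h1 h2] := modulus_ge_mean d0 s0 bs.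
  apply: le_trans (HD delta (delta +i* b) x d0 d0 h1) _.
  set r := cabs _ in h1 h2 *.
  have m0 : 0 < (delta + s) / 2 by rewrite divr_gt0// ltr_pwDl.
  have r0 : 0 < r by rewrite (lt_le_trans m0).
  have w := weight_ge a0 m0 h2 d0 h1.
  have w0 : 0 < Ld * ((delta + s) / 2) `^ 2^-1 by rewrite mulr_gt0// powR_gt0.
  rewrite /G /kappa [leRHS]mulrAC ler_wpM2r ?rnorm_ge0//.
  rewrite -!mulrA ler_wpM2l// ler_wpM2l ?(ltW d0)//.
  rewrite [leRHS]mulrCA ler_pM ?invr_ge0 ?(ltW r0) ?(ltW (weight_gt0 _ r0))//.
    by rewrite lef_pV2 ?posrE.
  by rewrite -invfM lef_pV2 ?posrE ?weight_gt0.
have := @decay_from_laplace R Y (fun u => C (S u x)) (fun lam => C (Hop A a lam x))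
  G delta.
have H1 y : rnorm (C (Hop A a 1 y)) <= B / weight alpha 1 * rnorm y.
  exact: (HB 1 y ltr01).
have B'0 : 0 <= B / weight alpha 1 by rewrite divr_ge0// ltW// weight_gt0.
move=> /(_ (fun psi psiL psi1 => observation_functional al asub par CL Ssol B'0 BS0
  H1 SB psiL psi1 Ax) d0 iG).
rewrite -/c /delta invrK -/delta GE intRZ// Ik => h.
have {}h : c * rnorm (C (S t x)) <=
    8 * N1 * rnorm x * (delta / Ld / (delta / 2) `^ 2^-1).
  apply: le_trans (h _) _ => [s s0|].
    by split; apply: LG => //; rewrite ?normrN ger0_norm.
  by rewrite le_eqVlt; apply/orP; left; apply/eqP; ring.
(* Since q ^+ 2 = delta / 2, the quotient delta / q is a multiple of delta^(1/2). *)
set q := (delta / 2) `^ 2^-1 in h.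
have q2 : q ^+ 2 = delta / 2.
  by rewrite /q -powR_mulrn ?powR_ge0// -powRrM mulVf// powRr1// divr_ge0 ?ltW.
have q0 : 0 < q by rewrite powR_gt0// divr_gt0.
have {}h : rnorm (C (S t x)) <= 8 * N1 / c * rnorm x * (delta / Ld / q).
  have -> : 8 * N1 / c * rnorm x * (delta / Ld / q) =
      (8 * N1 * rnorm x * (delta / Ld / q)) / c by ring.
  by rewrite ler_pdivlMr// mulrC.
have : rnorm (C (S t x)) ^+ 2 <= (8 * N1 / c * rnorm x * (delta / Ld / q)) ^+ 2.
  rewrite ler_pXn2r// nnegrE ?rnorm_ge0//.
  by rewrite (le_trans (rnorm_ge0 _) h).
move=> /le_trans; apply; rewrite le_eqVlt; apply/orP; left; apply/eqP.
have L2 : (1 + logplus delta) `^ (2 * alpha) = Ld ^+ 2.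
  by rewrite mulrC powRrM powR_mulrn// powR_ge0.
rewrite /log_profile -/delta L2.
clearbody c delta Ld q; rewrite !exprMn !exprVn q2.
by field; rewrite !gt_eqF.
Qed.

Lemma log_profile_le1 (R : realType) (alpha r : R) : 0 <= alpha -> 1 <= r ->
  log_profile alpha r <= 1.
Proof.
move=> a0 r1; have r0 : 0 < r by rewrite (lt_le_trans ltr01).
have p1 : 1 <= (1 + logplus r^-1) `^ (2 * alpha).
  rewrite -[leLHS](powRr0 (1 + logplus r^-1)) ler_powR ?mulr_ge0//.
  by rewrite lerDl logplus_ge0.
rewrite /log_profile -[leRHS]mulr1 ler_pM ?invr_ge0 ?(ltW r0) ?powR_ge0//.
  by rewrite invf_le1.
by rewrite invf_le1// (lt_le_trans ltr01).
Qed.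

Lemma log_profile_ge0 (R : realType) (alpha r : R) : 0 < r ->
  0 <= log_profile alpha r.
Proof. by move=> r0; rewrite mulr_ge0 ?invr_ge0 ?powR_ge0 ?ltW. Qed.

(** The profile is integrated over [d, 1] only, uniformly in d; the interval
    [0, d] is covered by the bound b, which contributes an arbitrarily small
    amount.  Beyond 1 the profile is at most 1. *)
Lemma integral_log_profile_dominated (R : realType) (f : R -> R)
    (alpha c b T : R) : 2^-1 < alpha -> 0 <= c -> 0 <= T ->
  (forall r, 0 <= r -> 0 <= f r <= b) ->
  (forall r, 0 < r -> f r <= c * log_profile alpha r) ->
  (\int[@lebesgue_measure R]_(r in `[0%R, T]) (f r)%:E <=
    (c * (T + (2 * alpha - 1)^-1))%:E)%E.
Proof.
move=> al c0 T0 fb fc.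
have a0 : 0 <= alpha by rewrite (le_trans _ (ltW al)).
have b0 : 0 <= b by have /andP[f0 /(le_trans f0)] := fb 0 (lexx 0).
apply/lee_addgt0Pr => e e0.
pose d : R := Num.min 2^-1 (e / (b + 1)).
have d0 : 0 < d by rewrite /d lt_min invr_gt0 ltr0n divr_gt0// ltr_wpDl.
have d1 : d < 1 by rewrite /d gt_min invf_lt1 ?ltr0n ?ltr1n.
have db : b * d <= e.
  have : d <= e / (b + 1) by rewrite /d ge_min lexx orbT.
  rewrite ler_pdivlMr ?ltr_wpDl//; apply: le_trans.
  by rewrite mulrDr mulr1 mulrC lerDl ltW.
have [il Il] := log_profile_integral al d0 d1.
have [i1 I1] := intR_indic_itv (ltW d0).
have [i2 I2] := intR_indic_itv T0.
pose g r := b * \1_(`[0, d]%classic : set R) r +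
  (c * (log_profile alpha \_ `[d, 1]) r + c * \1_(`[0, T]%classic : set R) r).
have ig : L1 g by apply: L1D; [|apply: L1D]; exact: L1Z.
apply: (@le_trans _ _ (intR g)%:E).
  rewrite -intR_EFin// integral_mkcond.
  apply: ge0_le_integral_nonmeasurable => r _.
    rewrite patchE; case: ifPn => //; rewrite inE/= in_itv/= => /andP[r0 _].
    by rewrite lee_fin; have /andP[] := fb r r0.
  have k0 : 0 <= (log_profile alpha \_ `[d, 1]) r.
    rewrite patchE; case: ifPn => //; rewrite inE/= in_itv/= => /andP[dr _].
    by rewrite log_profile_ge0// (lt_le_trans d0).
  have g1 : 0 <= b * \1_(`[0, d]%classic : set R) r by rewrite mulr_ge0// indicE.
  have g3 : 0 <= c * \1_(`[0, T]%classic : set R) r by rewrite mulr_ge0// indicE.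
  have g2 : 0 <= c * (log_profile alpha \_ `[d, 1]) r by rewrite mulr_ge0.
  rewrite patchE; case: ifPn => [|_]; last by rewrite lee_fin /g !addr_ge0.
  rewrite inE/= in_itv/= => rT; have /andP[r0 rT'] := rT.
  rewrite lee_fin; have /andP[_ fr] := fb r r0.
  have [rd|dr] := leP r d.
    apply: (le_trans fr); rewrite /g indicE mem_set/= ?in_itv/= ?r0// mulr1.
    by rewrite lerDl addr_ge0.
  have [r1|r1] := leP r 1.
    apply: (le_trans (fc r (lt_trans d0 dr))).
    rewrite /g patchE mem_set/= ?in_itv/= ?(ltW dr)//.
    by rewrite addrCA lerDl addr_ge0.
  apply: (le_trans (fc r (lt_trans d0 dr))).
  apply: (@le_trans _ _ (c * \1_(`[0, T]%classic : set R) r)).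
    rewrite indicE mem_set/= ?in_itv//= ler_wpM2l//.
    by rewrite log_profile_le1// ltW.
  by rewrite /g addrA lerDr addr_ge0.
rewrite -EFinD lee_fin /g intRD; [|exact: L1Z|by apply: L1D; exact: L1Z].
rewrite intRD; [|exact: L1Z|exact: L1Z].
rewrite !intRZ// I1 I2 !subr0 addrC lerD// [leLHS]addrC mulrDr lerD//.
by rewrite ler_wpM2l.
Qed.

Theorem theorem3p6 (R : realType) (X Y : completeNormedModType R[i])
    (A : unbounded_operator X) (omega : R) (a : R -> R[i])
    (S : R -> {linear X -> X}) (C : X -> Y) (alpha : R)
    (A_closed : closed_operator A)
    (A_dense : densely_defined A)
    (A_sectorial : opp_sectorial A omega)
    (a_L1loc : L1loc a)
    (a_subexp : subexponential a)
    (a_regular : regular 1 a)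
    (A_a_parabolic : parabolic A a)
    (S_solution : solution_family A a S)
    (S_bounded : bounded_family S)
    (C_bounded : graph_bounded_linear A C)
    (alpha_gt : 2^-1 < alpha)
    (C_H_bound :
      (ereal_sup [set opnorm (fun x : X =>
          ((1 + logplus r) `^ alpha * r `^ 2^-1)%:C *: C (Hop A a r%:C x))
        | r in [set r : R | (0 < r)%R]] < +oo)%E) :
  finite_time_admissible A S C.
Proof.
have a0 : 0 <= alpha by rewrite (le_trans _ (ltW alpha_gt)).
have [N N0 HN] := observation_decay a_L1loc a_subexp a_regular A_a_parabolic
  S_solution S_bounded C_bounded a0 C_H_bound.
pose c := (2 * alpha - 1)^-1.
have c0 : 0 < c by rewrite invr_gt0 subr_gt0 mulrC -ltr_pdivrMr// mul1r.
pose K := (N + 1) * (1 + c).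
have K1 : 1 <= K by rewrite /K mulr_ege1// ?lerDr ?lerDl// ltW.
have K0 : 0 < K by rewrite (lt_le_trans ltr01).
exists 1, K; split=> // t x t0 Ax.
have [BS BS0 SB'] := ereal_lty_bound S_bounded.
have SB r y : 0 <= r -> rnorm (S r y) <= BS * rnorm y.
  move=> r0; apply: opnorm_bound; first by move=> k z; rewrite linearZ.
  apply: le_trans SB'; apply: ereal_sup_ubound; exists r => //=.
  by rewrite in_itv/= r0.
have [_ _ _ SA _] := S_solution.
have [_ [M HM]] := C_bounded.
(* A bound for the integrand near 0 that depends on A x and is used only on a vanishing interval. *)
pose b := (`|M| * (BS * rnorm x + BS * rnorm (A x))) ^+ 2.
have fb r : 0 <= r -> 0 <= rnorm (C (S r x)) ^+ 2 <= b.
  move=> r0; rewrite sqr_ge0/= /b ler_pXn2r ?nnegrE ?rnorm_ge0//; last first.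
    by rewrite mulr_ge0// addr_ge0// mulr_ge0// rnorm_ge0.
  have [ASx ASE] := SA r x r0 Ax.
  apply: (le_trans (HM _ ASx)); rewrite ASE.
  have s0 : 0 <= rnorm (S r x) + rnorm (S r (A x)) by rewrite addr_ge0// rnorm_ge0.
  apply: (le_trans (ler_wpM2r s0 (ler_norm M))).
  by rewrite ler_wpM2l// lerD// SB.
have fc r : 0 < r -> rnorm (C (S r x)) ^+ 2 <=
    N * rnorm x ^+ 2 * log_profile alpha r.
  by move=> r0; rewrite mulrAC; exact: HN.
have Nx0 : 0 <= N * rnorm x ^+ 2 by rewrite mulr_ge0// sqr_ge0.
have I := integral_log_profile_dominated alpha_gt Nx0 t0 fb fc.
pose Z := K * expR (1 * t) * rnorm x.
have Z0 : 0 <= Z by rewrite mulr_ge0 ?rnorm_ge0// mulr_ge0 ?expR_ge0// ltW.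
have IZ : N * rnorm x ^+ 2 * (t + c) <= Z ^+ 2.
  rewrite mulrAC /Z mul1r exprMn ler_wpM2r ?sqr_ge0//.
  have E1 : 1 <= expR t by rewrite -expR0 ler_expR.
  have Et : t <= expR t by rewrite (le_trans _ (expR_ge1Dx t))// lerDr.
  have h1 : t + c <= (1 + c) * expR t.
    by rewrite mulrDl mul1r lerD// ler_peMr// ltW.
  have h2 : N * (t + c) <= K * expR t.
    rewrite /K -mulrA ler_pM// ?addr_ge0 ?(ltW c0)//.
    by rewrite lerDl.
  have h3 : 1 <= K * expR t by rewrite mulr_ege1.
  by rewrite (le_trans h2)// expr2 ler_peMr// (le_trans ler01 h3).
have pE : ((Z ^+ 2)%:E `^ 2^-1 = Z%:E)%E.
  by rewrite poweR_EFin -powR_mulrn// -powRrM mulfV// powRr1.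
rewrite -/Z -pE; apply: gt0_ler_poweR.
- by rewrite invr_ge0.
- by rewrite in_itv/= leey andbT integral_ge0// => r _; rewrite lee_fin sqr_ge0.
- by rewrite in_itv/= leey andbT lee_fin sqr_ge0.
- by rewrite (le_trans I)// lee_fin.
Qed.
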